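(* Let $A$ be a commutative Noetherian ring, and fix $r\ge 1$. For each $J\in\mathbb{Z}_{\ge 0}^r$, there exists $N=N_{r,J,A}\ge 0$ such that for all $n$: $$R^{(r)}_J(n)^\vee=\operatorname*{colim}_{S\subset[n],\ |S|\le N}R^{(r)}_J(S)^\vee,$$ that is, the natural map from the colimit to $R^{(r)}_J(n)^\vee$ is an isomorphism.
   Context: $[n]=\{1,\dots,n\}$, $[0]=\emptyset$. For a finite set $T$, let $A[\mathbf{X}^{(r)}(T)]$ be the polynomial $A$-algebra on generators $x_{(i,t)}$ indexed by $(i,t)\in[r]\times T$, with the $\mathbb{Z}_{\ge 0}^r$-grading whose $i$th component is the total degree in the generators $x_{(i,t)}$, $t\in T$. The permutation group $S_T$ of $T$ acts by permuting the second index. Let $I_T$ be the ideal generated by the $S_T$-invariant polynomials with zero constant term, and let $R^{(r)}(T)=A[\mathbf{X}^{(r)}(T)]/I_T$, with the induced grading; $R^{(r)}_J(T)$ is the graded piece of multidegree $J$, $R^{(r)}_J(n)=R^{(r)}_J([n])$, and $R^{(r)}_J(T)^\vee=\operatorname{Hom}_A(R^{(r)}_J(T),A)$. An injection $f\colon S\hookrightarrow T$ induces $f^*\colon A[\mathbf{X}^{(r)}(T)]\to A[\mathbf{X}^{(r)}(S)]$, with $f^*(x_{(i,t)})=x_{(i,s)}$ if $f(s)=t$ and $f^*(x_{(i,t)})=0$ if $t\notin\operatorname{im}f$; it satisfies $f^*(I_T)\subset I_S$, hence induces $R^{(r)}_J(T)\to R^{(r)}_J(S)$ and dually $R^{(r)}_J(S)^\vee\to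 R^{(r)}_J(T)^\vee$. The colimit is taken in $A$-modules over the poset of subsets $S\subset[n]$ with $|S|\le N$ ordered by inclusion, with the maps induced by inclusions; the natural map to $R^{(r)}_J(n)^\vee$ is induced by the inclusions $S\subset[n]$. *)

(* Defs.v *)
From HB Require Import structures.
From mathcomp Require Import all_boot all_order all_fingroup all_algebra.
From mathcomp Require Import finmap boolp.
From mathcomp Require Import generic_quotient ring_quotient monalg.

Set Implicit Arguments.
Unset Strict Implicit.
Unset Printing Implicit Defensive.

Import GRing.Theory.

Local Open Scope ring_scope.
Local Open Scope quotient_scope.

Section Generation.

Definition ideal_gen (R : comNzRingType) (G : R -> Prop) (x : R) : Prop :=
  exists s : seq (R * R),
    (forall cg, cg \in s -> G cg.2) /\ x = \sum_(cg <- s) cg.1 * cg.2.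

Definition submod_gen (R : comNzRingType) (V : lmodType R)
    (G : V -> Prop) (x : V) : Prop :=
  exists s : seq (R * V),
    (forall cg, cg \in s -> G cg.2) /\ x = \sum_(cg <- s) cg.1 *: cg.2.

Definition noetherian (R : comNzRingType) : Prop :=
  forall I : R -> Prop,
    I 0 -> (forall x y, I x -> I y -> I (x + y)) ->
    (forall a x, I x -> I (a * x)) ->
  exists s : seq R, forall x, I x <-> ideal_gen (fun g => g \in s) x.

End Generation.

Section LmodQuotient.
Variables (R : comNzRingType) (V : lmodType R) (W : submodClosed V).

(* A copy of W: in this library version a submodClosed predicate on an lmodType
   is not inferred to be a zmodClosed one, as {ideal_quot _} requires *)
Definition lquot_pred : {pred V} := fun x => x \in W.
Fact lquot_pred_zmod : zmod_closed lquot_pred.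
Proof. exact: GRing.submod_closedB (submodClosedP W). Qed.
HB.instance Definition _ :=
  GRing.isZmodClosed.Build V lquot_pred lquot_pred_zmod.

Definition lquot : Type := {ideal_quot lquot_pred}.
HB.instance Definition _ := GRing.Zmodule.on lquot.

Definition lquot_pi (v : V) : lquot := \pi_({ideal_quot lquot_pred}) v.
Definition lquot_scale (a : R) (q : lquot) : lquot :=
  lquot_pi (a *: repr (q : {ideal_quot lquot_pred})).

Lemma lquot_piP (x y : V) : reflect (lquot_pi x = lquot_pi y) (x - y \in W).
Proof.
by rewrite -[_ \in W]/(_ \in lquot_pred) Quotient.idealrBE; exact: eqP.
Qed.

Lemma lquot_reprK (q : lquot) :
  lquot_pi (repr (q : {ideal_quot lquot_pred})) = q.
Proof. exact: reprK. Qed.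

Lemma lquot_piB : zmod_morphism lquot_pi.
Proof. by move=> x y; rewrite /lquot_pi raddfB. Qed.
HB.instance Definition _ :=
  GRing.isZmodMorphism.Build V lquot lquot_pi lquot_piB.

Lemma lquot_piZ_def a x : lquot_scale a (lquot_pi x) = lquot_pi (a *: x).
Proof.
apply/lquot_piP; rewrite -scalerBr rpredZ //; apply/lquot_piP.
exact: lquot_reprK.
Qed.

Fact lquot_scaleA a b q :
  lquot_scale a (lquot_scale b q) = lquot_scale (a * b) q.
Proof. by rewrite -[q]lquot_reprK !lquot_piZ_def scalerA. Qed.
Fact lquot_scale1 : left_id 1 lquot_scale.
Proof. by move=> q; rewrite -[q]lquot_reprK !lquot_piZ_def scale1r. Qed.
Fact lquot_scaleDr : right_distributive lquot_scale +%R.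
Proof.
move=> a q q'; rewrite -[q]lquot_reprK -[q']lquot_reprK.
by rewrite -raddfD !lquot_piZ_def scalerDr raddfD.
Qed.
Fact lquot_scaleDl q : {morph lquot_scale^~ q : a b / a + b}.
Proof.
by move=> a b; rewrite -[q]lquot_reprK !lquot_piZ_def scalerDl raddfD.
Qed.
HB.instance Definition _ := GRing.Zmodule_isLmodule.Build R lquot
  lquot_scaleA lquot_scale1 lquot_scaleDr lquot_scaleDl.

Lemma lquot_piZ : scalable lquot_pi.
Proof. by move=> a x; rewrite -lquot_piZ_def. Qed.
HB.instance Definition _ :=
  GRing.isScalable.Build R V lquot *:%R lquot_pi lquot_piZ.

Section Lift.
Variables (U : lmodType R) (f : {linear V -> U}).
Hypothesis fW : forall x, x \in W -> f x = 0.

(* The proof argument is unused by the computation, which goes through a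
   representative, but makes the lift well defined and linear *)
Definition lquot_lift of (forall x, x \in W -> f x = 0) : lquot -> U :=
  fun q => f (repr (q : {ideal_quot lquot_pred})).

Lemma lquot_liftE x : lquot_lift fW (lquot_pi x) = f x.
Proof.
apply/eqP; rewrite -subr_eq0 -raddfB; apply/eqP/fW/lquot_piP.
exact: lquot_reprK.
Qed.

Lemma lquot_lift_is_linear : linear (lquot_lift fW).
Proof.
move=> a q q'; rewrite -[q]lquot_reprK -[q']lquot_reprK -linearP.
by rewrite !lquot_liftE linearP.
Qed.
HB.instance Definition _ :=
  GRing.isLinear.Build R lquot U *:%R (lquot_lift fW) lquot_lift_is_linear.
End Lift.
End LmodQuotient.

Section Dual.
Variables (R : comNzRingType).

Definition dual (V : lmodType R) : Type := {linear V -> R^o}.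

Section DualLmod.
Variable V : lmodType R.
Implicit Types f g h : dual V.

Definition dual_app f (x : V) : R := (f : {linear V -> R^o}) x.
Coercion dual_app : dual >-> Funclass.

HB.instance Definition _ := gen_eqMixin (dual V).
HB.instance Definition _ := gen_choiceMixin (dual V).

Lemma dualP f g : f =1 g -> f = g.
Proof.
case: f g => [f [[fa] [fs]]] [g [[ga] [gs]]] fg.
have {}fg : f = g by exact: funext fg.
case: _ / fg in ga gs *.
by rewrite (Prop_irrelevance fa ga) (Prop_irrelevance fs gs).
Qed.

Definition dual0 : dual V := (\0 : {linear V -> R^o}).
Definition dualN f : dual V := \- (f : {linear V -> R^o}) : {linear V -> R^o}.
Definition dualD f g : dual V :=
  (f : {linear V -> R^o}) \+ (g : {linear V -> R^o}) : {linear V -> R^o}.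
Definition dualZ (a : R) f : dual V :=
  a \*: (f : {linear V -> R^o}) : {linear V -> R^o}.

Fact dualDA : associative dualD.
Proof. by move=> f g h; apply: dualP => x; exact: addrA. Qed.
Fact dualDC : commutative dualD.
Proof. by move=> f g; apply: dualP => x; exact: addrC. Qed.
Fact dual0D : left_id dual0 dualD.
Proof. by move=> f; apply: dualP => x; exact: add0r. Qed.
Fact dualND : left_inverse dual0 dualN dualD.
Proof. by move=> f; apply: dualP => x; exact: addNr. Qed.
HB.instance Definition _ :=
  GRing.isZmodule.Build (dual V) dualDA dualDC dual0D dualND.

Fact dualZA a b f : dualZ a (dualZ b f) = dualZ (a * b) f.
Proof. by apply: dualP => x; exact: mulrA. Qed.
Fact dual1Z : left_id 1 dualZ.
Proof. by move=> f; apply: dualP => x; exact: mul1r. Qed.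
Fact dualZDr : right_distributive dualZ +%R.
Proof. by move=> a f g; apply: dualP => x; exact: mulrDr. Qed.
Fact dualZDl f : {morph dualZ^~ f : a b / a + b}.
Proof. by move=> a b; apply: dualP => x; exact: mulrDl. Qed.
HB.instance Definition _ :=
  GRing.Zmodule_isLmodule.Build R (dual V) dualZA dual1Z dualZDr dualZDl.

End DualLmod.

Section DualMap.
Variables (V U : lmodType R) (u : {linear V -> U}).

Definition dual_map (f : dual U) : dual V :=
  ((f : {linear U -> R^o}) \o u : {linear V -> R^o}).

Lemma dual_map_is_linear : linear dual_map.
Proof. by move=> a f g; apply: dualP. Qed.
HB.instance Definition _ :=
  GRing.isLinear.Build R (dual U) (dual V) *:%R dual_map dual_map_is_linear.
End DualMap.
End Dual.

Section DirectSum.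
Variables (R : comNzRingType) (I : finType) (F : I -> lmodType R).

(* As I is finite, the direct sum of the F i is their product *)
Definition dsum : Type := forall i, F i.
HB.instance Definition _ := gen_eqMixin dsum.
HB.instance Definition _ := gen_choiceMixin dsum.

Implicit Types x y z : dsum.

Lemma dsumP x y : (forall i, x i = y i) -> x = y.
Proof. exact: functional_extensionality_dep. Qed.

Definition dsum0 : dsum := fun i => 0.
Definition dsumN x : dsum := fun i => - x i.
Definition dsumD x y : dsum := fun i => x i + y i.
Definition dsumZ (a : R) x : dsum := fun i => a *: x i.

Fact dsumDA : associative dsumD.
Proof. by move=> x y z; apply: dsumP => i; exact: addrA. Qed.
Fact dsumDC : commutative dsumD.
Proof. by move=> x y; apply: dsumP => i; exact: addrC. Qed.
Fact dsum0D : left_id dsum0 dsumD.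
Proof. by move=> x; apply: dsumP => i; exact: add0r. Qed.
Fact dsumND : left_inverse dsum0 dsumN dsumD.
Proof. by move=> x; apply: dsumP => i; exact: addNr. Qed.
HB.instance Definition _ :=
  GRing.isZmodule.Build dsum dsumDA dsumDC dsum0D dsumND.

Fact dsumZA a b x : dsumZ a (dsumZ b x) = dsumZ (a * b) x.
Proof. by apply: dsumP => i; exact: scalerA. Qed.
Fact dsum1Z : left_id 1 dsumZ.
Proof. by move=> x; apply: dsumP => i; exact: scale1r. Qed.
Fact dsumZDr : right_distributive dsumZ +%R.
Proof. by move=> a x y; apply: dsumP => i; exact: scalerDr. Qed.
Fact dsumZDl x : {morph dsumZ^~ x : a b / a + b}.
Proof. by move=> a b; apply: dsumP => i; exact: scalerDl. Qed.
HB.instance Definition _ :=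
  GRing.Zmodule_isLmodule.Build R dsum dsumZA dsum1Z dsumZDr dsumZDl.

Definition dsum_in (i : I) (v : F i) : dsum := dfwith dsum0 v.

Lemma dsum_in_is_linear i : linear (@dsum_in i).
Proof.
move=> a u v; apply: dsumP => j.
rewrite /dsum_in -[RHS]/(a *: dfwith dsum0 u j + dfwith dsum0 v j).
have [<-|nij] := eqVneq i j; first by rewrite !dfwith_in.
by rewrite !dfwith_out // scaler0 addr0.
Qed.
HB.instance Definition _ i :=
  GRing.isLinear.Build R (F i) dsum *:%R (@dsum_in i) (@dsum_in_is_linear i).

Definition dsum_app (i : I) (x : dsum) : F i := x i.
Lemma dsum_app_is_linear i : linear (@dsum_app i). Proof. by []. Qed.
HB.instance Definition _ i :=
  GRing.isLinear.Build R dsum (F i) *:%R (@dsum_app i) (@dsum_app_is_linear i).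

Lemma dsumE x : x = \sum_i dsum_in (x i).
Proof.
apply: dsumP => j.
rewrite -[RHS]/(dsum_app j _) linear_sum (bigD1 j) //= big1 ?addr0.
  by rewrite /dsum_app /dsum_in dfwith_in.
by move=> i nij; rewrite /dsum_app /dsum_in dfwith_out.
Qed.

Section Desc.
Variables (M : lmodType R) (g : forall i, {linear F i -> M}).
Definition dsum_desc (x : dsum) : M := \sum_i g i (x i).

Lemma dsum_desc_is_linear : linear dsum_desc.
Proof.
move=> a x y; rewrite /dsum_desc scaler_sumr -big_split.
by apply: eq_bigr => i _; exact: (linearP (g i)).
Qed.
HB.instance Definition _ :=
  GRing.isLinear.Build R dsum M *:%R dsum_desc dsum_desc_is_linear.

Lemma dsum_desc_in i v : dsum_desc (@dsum_in i v) = g i v.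
Proof.
rewrite /dsum_desc (bigD1 i) //= big1 ?addr0 /dsum_in ?dfwith_in //.
by move=> j nij; rewrite dfwith_out 1?eq_sym // linear0.
Qed.
End Desc.
End DirectSum.

Section Colimit.
Variables (R : comNzRingType) (I : finType) (le : rel I) (F : I -> lmodType R).
Variable (t : forall i j, le i j -> {linear F i -> F j}).

(* The colimit of the diagram (F, t) indexed by (I, le) is the direct sum of the
   F i modulo the identifications of v in F i with its image in F j, i <= j;
   its universal property is colim_in_compat, colim_desc_in, colim_desc_uniq *)
Definition colim_gen (x : dsum F) : Prop :=
  exists i j (ij : le i j) (v : F i), x = dsum_in v - dsum_in (t ij v).

Definition colim_rel : {pred dsum F} := fun x => `[< submod_gen colim_gen x >].

Lemma colim_rel_closed : submod_closed colim_rel.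
Proof.
split; first by apply/asboolP; exists [::]; split=> //; rewrite big_nil.
move=> a x y /asboolP[s [sG ->]] /asboolP[s' [s'G ->]]; apply/asboolP.
exists ([seq (a * cg.1, cg.2) | cg <- s] ++ s'); split.
  move=> cg; rewrite mem_cat => /orP[/mapP[cg' /sG ? ->] //|]; exact: s'G.
rewrite big_cat big_map scaler_sumr; congr (_ + _).
by apply: eq_bigr => cg _; rewrite scalerA.
Qed.
HB.instance Definition _ :=
  GRing.isSubmodClosed.Build R (dsum F) colim_rel colim_rel_closed.

Definition colim : lmodType R := lquot colim_rel.

Definition colim_in i : {linear F i -> colim} :=
  @lquot_pi R (dsum F) colim_rel \o @dsum_in R I F i.

Lemma colim_in_compat i j (ij : le i j) v :
  colim_in j (t ij v) = colim_in i v.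
Proof.
apply/esym/lquot_piP/asboolP; exists [:: (1, dsum_in v - dsum_in (t ij v))].
split; last by rewrite big_seq1 scale1r.
by move=> cg; rewrite inE => /eqP ->; exists i, j, ij, v.
Qed.

Section Desc.
Variables (M : lmodType R) (g : forall i, {linear F i -> M}).
Hypothesis gt : forall i j (ij : le i j) v, g j (t ij v) = g i v.

Lemma colim_rel_desc x : x \in colim_rel -> dsum_desc g x = 0.
Proof.
move=> /asboolP[s [sG ->]]; rewrite linear_sum big_seq big1 // => cg /sG.
move=> [i [j [ij [v ->]]]].
by rewrite linearZ linearB /= !dsum_desc_in gt subrr scaler0.
Qed.

Definition colim_desc : {linear colim -> M} := lquot_lift colim_rel_desc.

Lemma colim_desc_in i v : colim_desc (colim_in i v) = g i v.
Proof. by rewrite [LHS](lquot_liftE colim_rel_desc); exact: dsum_desc_in. Qed.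

Lemma colim_desc_uniq (h : {linear colim -> M}) :
  (forall i v, h (colim_in i v) = g i v) -> h =1 colim_desc.
Proof.
move=> hg x; rewrite -[x]lquot_reprK [repr _]dsumE !linear_sum.
by apply: eq_bigr => i _; rewrite -[LHS]/(h (colim_in i _)) hg -colim_desc_in.
Qed.
End Desc.
End Colimit.

Section Substitution.
Variables (A : comNzRingType) (I J : finType).
Variable v : I -> {malg A[{cmonom J}]}.

Definition mnm_subst (m : {cmonom I}) : {malg A[{cmonom J}]} :=
  \prod_(k : I) v k ^+ m k.

Lemma mnm_subst_morphism : mmorphism mnm_subst.
Proof.
split=> [m m'|]; last by rewrite /mnm_subst big1 // => k _; rewrite cm1.
by rewrite /mnm_subst -big_split; apply: eq_bigr => k _; rewrite cmM exprD.
Qed.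
HB.instance Definition _ :=
  isMultiplicative.Build {cmonom I} {malg A[{cmonom J}]} mnm_subst
    mnm_subst_morphism.

(* The A-algebra morphism sending each generator k to v k *)
Definition psubst : {malg A[{cmonom I}]} -> {malg A[{cmonom J}]} :=
  mmap (@malgC {cmonom J} A) mnm_subst.
HB.instance Definition _ := GRing.RMorphism.on psubst.

Lemma psubstZ : scalable psubst.
Proof. by move=> a p; rewrite /psubst mmapZ mul_malgC. Qed.
HB.instance Definition _ :=
  GRing.isScalable.Build A _ _ *:%R psubst psubstZ.

Lemma psubstE p : psubst p = \sum_(m <- msupp p) p@_m *: mnm_subst m.
Proof. by rewrite /psubst mmapE; apply: eq_bigr => m _; rewrite mul_malgC. Qed.

Lemma psubstU c m : psubst << c *g m >> = c *: mnm_subst m.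
Proof. by rewrite /psubst mmapU mul_malgC. Qed.

Lemma psubstX k : psubst << ucm k >> = v k.
Proof.
rewrite psubstU scale1r /mnm_subst (bigD1 k) //= big1 ?mulr1.
  by rewrite cmUU expr1.
by move=> j /negbTE jk; rewrite cmU eq_sym jk.
Qed.

Lemma rmorph_mnm_subst (e : {rmorphism {malg A[{cmonom J}]} -> A}) m :
  (forall k, e (v k) = 0) -> e (mnm_subst m) = (m == mone)%:R.
Proof.
move=> ev0; rewrite rmorph_prod; have [->|m1] := eqVneq m mone.
  by rewrite big1 // => k _; rewrite cm1 expr0 rmorph1.
have /existsP[k mk] : [exists k, m k != 0%N].
  apply: contraR m1; rewrite negb_exists => /forallP m0.
  by apply/cmP => k; rewrite cm1; apply/eqP; move: (m0 k); rewrite negbK.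
have ek : e (v k ^+ m k) = 0.
  by rewrite (rmorphXn e) ev0 expr0n (negbTE mk).
by rewrite (bigD1 k) //; apply: etrans (mul0r _); congr (_ * _); exact: ek.
Qed.

Lemma mcoeff1_subst : (forall k, (v k)@_mone = 0) ->
  forall p, (psubst p)@_mone = p@_mone.
Proof.
move=> v0 p; rewrite psubstE {3}[p]monalgE !raddf_sum /=; apply: eq_bigr => m _.
rewrite mcoeffZ mcoeffU -[X in _ * X]/(mcoeff mone (mnm_subst m)).
by rewrite rmorph_mnm_subst // mulr_natr.
Qed.
End Substitution.

Lemma psubst_comp (A : comNzRingType) (I J K : finType)
    (v : I -> {malg A[{cmonom J}]}) (w : J -> {malg A[{cmonom K}]}) p :
  psubst w (psubst v p) = psubst (fun k => psubst w (v k)) p.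
Proof.
rewrite !(psubstE _ p) linear_sum /=; apply: eq_bigr => m _.
rewrite linearZ /= /mnm_subst rmorph_prod; congr (_ *: _).
by apply: eq_bigr => k _; rewrite rmorphXn.
Qed.

Lemma eq_psubst (A : comNzRingType) (I J : finType)
    (v w : I -> {malg A[{cmonom J}]}) : v =1 w -> psubst v =1 psubst w.
Proof. by move=> /funext ->. Qed.

Section Coinvariants.
Variables (A : comNzRingType) (r : nat).

Local Notation poly T := {malg A[{cmonom ('I_r * T)%type}]}.
Local Notation "'x_(' i , t )" := << ucm (i, t) >>.

(* s acts by x_(i, t) |-> x_(i, s t) *)
Definition perm_act (T : finType) (s : {perm T}) : poly T -> poly T :=
  psubst (fun it : 'I_r * T => x_(it.1, s it.2)).

(* p@_mone is the constant term *)
Definition inv_gen (T : finType) (p : poly T) : Prop :=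
  (forall s : {perm T}, perm_act s p = p) /\ p@_mone = 0.

Definition coinv_ideal (T : finType) : {pred poly T} :=
  fun p => `[< ideal_gen (@inv_gen T) p >].

Lemma coinv_ideal_closed (T : finType) : submod_closed (@coinv_ideal T).
Proof.
split; first by apply/asboolP; exists [::]; split=> //; rewrite big_nil.
move=> a x y /asboolP[s [sG ->]] /asboolP[s' [s'G ->]]; apply/asboolP.
exists ([seq (a *: cg.1, cg.2) | cg <- s] ++ s'); split.
  move=> cg; rewrite mem_cat => /orP[/mapP[cg' /sG ? ->] //|]; exact: s'G.
rewrite big_cat big_map scaler_sumr; congr (_ + _).
by apply: eq_bigr => cg _; rewrite scalerAl.
Qed.
HB.instance Definition _ (T : finType) :=
  GRing.isSubmodClosed.Build A (poly T) (@coinv_ideal T)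
    (@coinv_ideal_closed T).

Definition coinv (T : finType) : lmodType A := lquot (@coinv_ideal T).

(* As usual, 0 is multihomogeneous of every multidegree *)
Definition multihomog (J : 'I_r -> nat) (T : finType) (p : poly T) : Prop :=
  forall m, m \in msupp p -> forall i, (\sum_(t : T) m (i, t))%N = J i.

Section Multihomog.
Variable T : finType.
Implicit Types (J : 'I_r -> nat) (p q : poly T).

Lemma eq_multihomog J J' p :
  multihomog J p -> (forall i, J i = J' i) -> multihomog J' p.
Proof. by move=> pJ JJ' m /pJ mJ i; rewrite mJ. Qed.

Lemma multihomog0 J : multihomog J (0 : poly T).
Proof. by move=> m; rewrite msupp0. Qed.

Lemma multihomogD J p q :
  multihomog J p -> multihomog J q -> multihomog J (p + q).
Proof.
move=> pJ qJ m /(fsubsetP (msuppD_le _ _)).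
by rewrite in_fsetU => /orP[/pJ | /qJ].
Qed.

Lemma multihomogZ J a p : multihomog J p -> multihomog J (a *: p).
Proof. by move=> pJ m /(fsubsetP (msuppZ_le _ _)) /pJ. Qed.

Lemma multihomog1 : multihomog (fun=> 0%N) (1 : poly T).
Proof.
move=> m; rewrite -mcoeff_neq0 mcoeff1; have [-> _ i|] := eqVneq m mone.
  by rewrite big1 // => t _; rewrite cm1.
by rewrite eqxx.
Qed.

Lemma multihomogM J J' p q : multihomog J p -> multihomog J' q ->
  multihomog (fun i => J i + J' i)%N (p * q).
Proof.
move=> pJ qJ' m /msuppM_le[m1 [m2 [/pJ m1J /qJ' m2J ->]]] i.
by rewrite -m1J -m2J -big_split; apply: eq_bigr => t _; rewrite cmM.
Qed.

Lemma multihomogX J p k :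
  multihomog J p -> multihomog (fun i => k * J i)%N (p ^+ k).
Proof.
move=> pJ; elim: k => [|k IHk]; first exact: multihomog1.
rewrite exprS; apply: eq_multihomog (multihomogM pJ IHk) _ => i.
by rewrite mulSn.
Qed.

Lemma multihomog_prod (K : finType) (d : K -> 'I_r -> nat) (p : K -> poly T) :
  (forall k, multihomog (d k) (p k)) ->
  multihomog (fun i => \sum_k d k i)%N (\prod_k p k).
Proof.
move=> pd; elim: (index_enum K) => [|k s IHs].
  by rewrite big_nil; apply: eq_multihomog multihomog1 _ => i; rewrite big_nil.
rewrite big_cons; apply: eq_multihomog (multihomogM (pd k) IHs) _ => i.
by rewrite big_cons.
Qed.
End Multihomog.

Section Graded.
Variables (J : 'I_r -> nat) (T : finType).

(* The induced grading: the piece of multidegree J of the quotient is the image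
   of the piece of multidegree J of the polynomial ring *)
Definition coinv_piece : {pred coinv T} := fun q =>
  `[< exists2 p : poly T, multihomog J p & lquot_pi (@coinv_ideal T) p = q >].

Lemma coinv_piece_closed : submod_closed coinv_piece.
Proof.
split.
  by apply/asboolP; exists 0; rewrite ?linear0 //; exact: multihomog0.
move=> a x y /asboolP[p pJ <-] /asboolP[q qJ <-]; apply/asboolP.
exists (a *: p + q); last by rewrite linearP.
exact: multihomogD (multihomogZ pJ) qJ.
Qed.
HB.instance Definition _ :=
  GRing.isSubmodClosed.Build A (coinv T) coinv_piece coinv_piece_closed.

Record Rgraded := MkRgraded { Rval : coinv T; _ : Rval \in coinv_piece }.
HB.instance Definition _ := [isSub for Rval].
HB.instance Definition _ := [Choice of Rgraded by <:].
HB.instance Definition _ := [SubChoice_isSubLmodule of Rgraded by <:].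
End Graded.

Section Functoriality.
Variables (S T : finType) (f : S -> T).

(* The s with f s = it.2 is unique, as f is assumed injective below *)
Definition pullX (it : 'I_r * T) : poly S :=
  if [pick s | f s == it.2] is Some s then x_(it.1, s) else 0.

Definition pull : poly T -> poly S := psubst pullX.
HB.instance Definition _ := GRing.LRMorphism.on pull.

Lemma pullX1 it : (pullX it)@_mone = 0.
Proof.
rewrite /pullX; case: pickP => [s _|_]; last by rewrite mcoeff0.
by rewrite mcoeffU1 cm1_eq1.
Qed.

Lemma pullX_homog it : multihomog (fun i => (it.1 == i) : nat) (pullX it).
Proof.
rewrite /pullX; case: pickP => [s _|_]; last exact: multihomog0.
move=> m; rewrite msuppU1 in_fset1 => /eqP -> i.
rewrite (bigD1 s) //= big1 ?addn0 => [|t /negbTE ts].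
  by rewrite cmU xpair_eqE eqxx andbT.
by rewrite cmU xpair_eqE [s == t]eq_sym ts andbF.
Qed.

Lemma pull_homog J p : multihomog J p -> multihomog J (pull p).
Proof.
move=> pJ; rewrite /pull psubstE big_seq.
elim/big_ind: _ => [|q q' qJ q'J|m /pJ mJ]; first exact: multihomog0.
  exact: multihomogD.
apply: multihomogZ.
suff /eq_multihomog : multihomog (fun i => \sum_it m it * (it.1 == i))%N
    (mnm_subst pullX m).
  apply=> i; rewrite -mJ (eq_bigr (fun it => m (it.1, it.2) * (it.1 == i)))%N.
    rewrite -(pair_bigA _ (fun i' t => m (i', t) * (i' == i)))%N /=.
    rewrite (bigD1 i) //= [X in (_ + X)%N]big1 ?addn0.
      by apply: eq_bigr => t _; rewrite eqxx muln1.
    by move=> j /negbTE ji; rewrite big1 // => t _; rewrite ji muln0.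
  by case.
by apply: multihomog_prod => it; exact/multihomogX/pullX_homog.
Qed.

Hypothesis f_inj : injective f.

Lemma pullX_im i s : pullX (i, f s) = x_(i, s).
Proof.
rewrite /pullX; case: pickP => [s' /eqP /f_inj -> //|/(_ s)].
by rewrite eqxx.
Qed.

Lemma perm_extend_proof (s : {perm S}) :
  injective (fun t => if [pick u | f u == t] is Some u then f (s u) else t).
Proof.
move=> t t'; case: pickP => [u /eqP <-|nt]; case: pickP => [u' /eqP <-|nt'].
- by move/f_inj/perm_inj ->.
- by move=> tE; move: (nt' (s u)); rewrite tE eqxx.
- by move=> tE; move: (nt (s u')); rewrite tE eqxx.
- by [].
Qed.
Definition perm_extend s : {perm T} := perm (@perm_extend_proof s).

Lemma pull_inv p : inv_gen p -> inv_gen (pull p).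
Proof.
move=> [pS p0]; split; last by rewrite mcoeff1_subst //; exact: pullX1.
move=> s; rewrite -{2}(pS (perm_extend s)) /pull /perm_act !psubst_comp.
apply: eq_psubst => -[i t] /=; rewrite psubstX permE /pullX /=.
case: pickP => [u _|nt].
  by rewrite psubstX -[RHS]/(pullX (i, _)) pullX_im.
by rewrite rmorph0; case: pickP => // u; rewrite nt.
Qed.

Lemma pull_ideal p : p \in @coinv_ideal T -> pull p \in @coinv_ideal S.
Proof.
move=> /asboolP[s [sG ->]]; apply/asboolP.
exists [seq (pull cg.1, pull cg.2) | cg <- s]; split.
  by move=> _ /mapP[cg /sG cgG ->]; exact: pull_inv.
by rewrite rmorph_sum big_map; apply: eq_bigr => cg _; rewrite rmorphM.
Qed.

Lemma coinv_pull_proof p : p \in @coinv_ideal T ->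
  (@lquot_pi A (poly S) (@coinv_ideal S) \o pull) p = 0.
Proof.
move=> /pull_ideal pI /=; rewrite -[RHS](linear0 (lquot_pi _)).
by apply/lquot_piP; rewrite subr0.
Qed.

Definition coinv_pull : {linear coinv T -> coinv S} :=
  lquot_lift coinv_pull_proof.

Lemma coinv_pullE p :
  coinv_pull (lquot_pi (@coinv_ideal T) p) =
  lquot_pi (@coinv_ideal S) (pull p).
Proof. exact: (lquot_liftE coinv_pull_proof). Qed.

Section Piece.
Variable J : 'I_r -> nat.

Lemma Rpull_proof (q : Rgraded J T) : coinv_pull (Rval q) \in @coinv_piece J S.
Proof.
case: q => q /= /asboolP[p pJ <-]; apply/asboolP; exists (pull p).
  exact: pull_homog.
exact: (esym (coinv_pullE p)).
Qed.

Definition Rpull (q : Rgraded J T) : Rgraded J S := MkRgraded (Rpull_proof q).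

Lemma Rpull_is_linear : linear Rpull.
Proof.
move=> a p q; apply: val_inj.
exact: (linearP coinv_pull a (Rval p) (Rval q)).
Qed.
HB.instance Definition _ :=
  GRing.isLinear.Build A (Rgraded J T) (Rgraded J S) *:%R Rpull Rpull_is_linear.
End Piece.
End Functoriality.

Section Composition.
Variables (S T U : finType) (f : S -> T) (g : T -> U) (h : S -> U).
Hypotheses (f_inj : injective f) (g_inj : injective g) (h_inj : injective h).
Hypothesis gfh : forall s, g (f s) = h s.

Lemma pull_comp p : pull f (pull g p) = pull h p.
Proof.
rewrite /pull psubst_comp; apply: eq_psubst => -[i u].
rewrite [in LHS]/pullX; case: pickP => [t /= /eqP <-|nt] /=.
  rewrite psubstX /pullX /=; case: pickP => [s /eqP <-|ns].
    by rewrite gfh -[RHS]/(pullX h (i, h s)) pullX_im.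
  by case: pickP => // s; rewrite -gfh => /eqP /g_inj /eqP; rewrite ns.
rewrite rmorph0 /pullX; case: pickP => //= s.
by rewrite -gfh => /eqP sE; move: (nt (f s)); rewrite sE eqxx.
Qed.

Lemma Rpull_comp J (q : Rgraded J U) :
  Rpull f_inj (Rpull g_inj q) = Rpull h_inj q.
Proof.
apply: val_inj; case: q => q qP.
rewrite -[LHS]/(coinv_pull f_inj (coinv_pull g_inj q)).
rewrite -[RHS]/(coinv_pull h_inj q) -[q]lquot_reprK.
by rewrite !coinv_pullE pull_comp.
Qed.
End Composition.

Section NaturalMap.
Variables (J : 'I_r -> nat) (n N : nat).

Definition incl (S S' : {set 'I_n}) (SS' : S \subset S')
    (x : {x | x \in S}) : {x | x \in S'} :=
  exist _ (val x) (subsetP SS' _ (valP x)).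

Lemma incl_inj (S S' : {set 'I_n}) (SS' : S \subset S') : injective (incl SS').
Proof. by move=> x y /(congr1 val) /= /val_inj. Qed.

Definition small_set : finType := {S : {set 'I_n} | (#|S| <= N)%N}.
Definition small_le : rel small_set := fun S S' => val S \subset val S'.

Definition small_dual (S : small_set) : lmodType A :=
  dual (Rgraded J {x | x \in val S}).

Definition small_map (S S' : small_set) (SS' : small_le S S') :
    {linear small_dual S -> small_dual S'} :=
  dual_map (Rpull (@incl_inj _ _ SS') (J := J)).

(* Induced by the inclusion of S in {0, .., n-1} *)
Definition small_to_full (S : small_set) :
    {linear small_dual S -> dual (Rgraded J 'I_n)} :=
  dual_map (Rpull (@val_inj _ _ {x | x \in val S}) (J := J)).

Lemma small_to_full_compat S S' (SS' : small_le S S') (phi : small_dual S) :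
  small_to_full S' (small_map SS' phi) = small_to_full S phi.
Proof.
by apply: dualP => q; congr (dual_app phi _); apply: Rpull_comp.
Qed.

Definition colim_to_dual :
    {linear colim small_map -> dual (Rgraded J 'I_n)} :=
  colim_desc small_to_full_compat.
End NaturalMap.
End Coinvariants.

(* Main.v *)
Require Import Defs.
From mathcomp Require Import all_boot all_algebra.
From mathcomp Require Import finmap boolp functions.
From mathcomp Require Import generic_quotient ring_quotient monalg.
From mathcomp Require Import zify.

(** For an injection [f : S -> nat], a functional [psi] on [R_J(S)] is determined
    by its values on the products of generators [x_(i_1, s_1) ... x_(i_k, s_k)],
    where [i_1 ... i_k] is the fixed word with [J i] letters [i]; it thus becomes
    a function of the word [f s_1 ... f s_k].  As [S] varies, this realizes the
    duals as a submodule [W] of a free FI-module.  The colimit over small subsets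
    is the whole dual as soon as, for [S] large, every element of [W S] is a sum
    of elements of the [W (S \ t)], and every relation between such elements
    comes from the [W (S \ {s, t})].

    This exactness holds for submodules of free FI-modules over a noetherian
    ring, by induction on the number of letters that can vary.  By noetherianity
    there is a finite set [G] of letters such that, for every small [D] disjoint
    from [G], the restrictions to words in [D] of arbitrary elements of [W]
    already come from [W (D + G)].  The image of [W] on words avoiding [G] is
    therefore the direct sum of its pieces of exact support, for which exactness
    is clear; the kernel lives on words meeting [G], which have fewer variable
    letters once the letters of [G] are frozen.  Finally the letters of [G] are
    unfrozen one by one. *)

Set Implicit Arguments.
Unset Strict Implicit.
Unset Printing Implicit Defensive.

Import GRing.Theory.

Local Open Scope fset_scope.
Local Open Scope ring_scope.

(** * Modules over a noetherian ring *)

Section Noetherian.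
Variable A : comNzRingType.
Hypothesis hA : noetherian A.

Section Submodule.
Variable V : lmodType A.

Record submodule (M : V -> Prop) : Prop := Submodule {
  submodule0 : M 0;
  submoduleD : forall x y, M x -> M y -> M (x + y);
  submoduleZ : forall a x, M x -> M (a *: x) }.

Variable M : V -> Prop.
Hypothesis hM : submodule M.

Lemma submoduleN x : M x -> M (- x).
Proof. by move=> Mx; rewrite -scaleN1r; exact: submoduleZ. Qed.

Lemma submoduleB x y : M x -> M y -> M (x - y).
Proof. by move=> Mx My; apply: submoduleD => //; exact: submoduleN. Qed.

Lemma submodule_sum (I : eqType) (s : seq I) (F : I -> V) :
  (forall i, i \in s -> M (F i)) -> M (\sum_(i <- s) F i).
Proof.
move=> MF; rewrite big_seq; elim/big_ind: _ => //; first exact: submodule0.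
exact: submoduleD.
Qed.

End Submodule.

(* The condition on Z says that psi is in the span of l *)
Lemma noetherian_restr (E : eqType) (M : (E -> A^o) -> Prop) (s : seq E) :
  submodule M -> exists2 l : seq (E -> A^o), (forall f, f \in l -> M f) &
  forall phi, M phi -> exists2 psi, {in s, phi =1 psi} &
    forall Z, submodule Z -> (forall f, f \in l -> Z f) -> Z psi.
Proof.
elim: s M => [|x s IHs] M hM.
  exists [::] => // phi _; exists 0 => // Z hZ _; exact: submodule0.
(* The values at [x] of elements of [M] form an ideal. Lifts of finitely many generators control the
   value at [x], and the kernel of evaluation at [x] is left to the induction hypothesis. *)
have [|||c hc] := hA (I := fun a => exists2 phi, M phi & phi x = a).
- by exists 0 => //; exact: submodule0.
- move=> _ _ [f Mf <-] [g Mg <-]; exists (f + g) => //; exact: submoduleD.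
- move=> a _ [f Mf <-]; exists (a *: f) => //; exact: submoduleZ.
have lift a : exists phi : E -> A^o, a \in c -> M phi /\ phi x = a.
  case: (boolP (a \in c)) => [ac|_]; last by exists 0.
  have /hc[phi] : ideal_gen (fun g => g \in c) a.
    exists [:: (1, a)]; rewrite big_seq1 mul1r; split=> // cg.
    by rewrite inE => /eqP ->.
  by exists phi.
have [L hL] := choice lift.
have hM' : submodule (fun phi => M phi /\ phi x = 0).
  split; first by split; [exact: submodule0 |].
    move=> f g [Mf f0] [Mg g0]; split; first exact: submoduleD.
    by rewrite fctE f0 g0 addr0.
  move=> a f [Mf f0]; split; first exact: submoduleZ.
  by rewrite fctE f0 scaler0.
have [l lM hl] := IHs _ hM'.
exists ([seq L a | a <- c] ++ l) => [f|phi Mphi].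
  rewrite mem_cat => /orP[/mapP[a ac ->]|/lM[] //]; exact: (hL a ac).1.
have /hc[t [tc xE]] : exists2 psi : E -> A^o,
  M psi & psi x = phi x by exists phi.
pose rho : E -> A^o := \sum_(cg <- t) cg.1 *: L cg.2.
have Mrho : M rho.
  apply: submodule_sum => // cg cgt; apply: submoduleZ => //.
  exact: (hL _ (tc _ cgt)).1.
have rhox : rho x = phi x.
  rewrite xE /rho fct_sumE !big_seq; apply: eq_bigr => cg cgt.
  by rewrite fctE (hL _ (tc _ cgt)).2.
have [|psi psiE hpsi] := hl (phi - rho).
  by split; [exact: submoduleB | rewrite !fctE rhox subrr].
(* The span condition on [psi] is used with the kernel of evaluation at [x] as [Z]. *)
have psix : psi x = 0.
  exact: (hpsi _ hM' lM).2.
exists (rho + psi).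
  move=> y; rewrite inE fctE => /orP[/eqP ->|ys].
    by rewrite rhox psix addr0.
  by rewrite -psiE // !fctE addrCA subrr addr0.
move=> Z hZ Zl; apply: submoduleD => //; last first.
  by apply: hpsi => // f fl; apply: Zl; rewrite mem_cat fl orbT.
apply: submodule_sum => // cg cgt; apply: submoduleZ => //; apply: Zl.
by rewrite mem_cat map_f // tc.
Qed.
End Noetherian.

(** * Exactness for families of functions on words *)

Implicit Types (S T U F G D : {fset nat}) (g : nat -> nat).

Section Words.
Variable P : finType.
Local Notation word := {ffun P -> nat}.
Implicit Types (e : word).

Definition supp e : {fset nat} := [fset e p | p in P].

Definition relabel g e : word := [ffun p => g (e p)].

Lemma supp_subP e S : reflect (forall p, e p \in S) (supp e `<=` S).
Proof.
apply: (iffP (@fsubsetP _ _ _)) => [sub p|sub x /imfsetP[p _ ->] //].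
by apply: sub; apply: in_imfset.
Qed.

Lemma supp_relabel g e : supp (relabel g e) = g @` supp e.
Proof.
apply/fsetP => x; apply/imfsetP/imfsetP =>
  /= [[p _ ->]|[y /imfsetP[p _ ->] ->]].
  by exists (e p); rewrite ?ffunE // in_imfset.
by exists p; rewrite ?ffunE.
Qed.

Lemma relabelK g g' : cancel g g' -> cancel (relabel g) (relabel g').
Proof. by move=> gK e; apply/ffunP => p; rewrite !ffunE gK. Qed.

Lemma card_supp e : (#|` supp e| <= #|P|)%N.
Proof. by rewrite (leq_trans (leq_imfset_card _ _ _)) //= -cardE. Qed.

Definition words S : seq word :=
  [seq [ffun p => val (h p)] | h : {ffun P -> S}].

Lemma mem_words S e : supp e `<=` S -> e \in words S.
Proof.
move=> /supp_subP eS; apply/mapP; exists [ffun p => [` eS p]].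
  by rewrite mem_enum.
by apply/ffunP => p; rewrite !ffunE.
Qed.

End Words.

Lemma imfset_can g g' S : cancel g g' -> g' @` (g @` S) = S :> {fset nat}.
Proof.
move=> gK; apply/fsetP => x;
  apply/imfsetP/idP => /= [[y /imfsetP[z zS ->] ->]|xS].
  by rewrite gK.
by exists (g x); rewrite ?gK // in_imfset.
Qed.

Lemma imfsetD1 g x S : injective g ->
  g @` (S `\ x) = (g @` S) `\ g x :> {fset nat}.
Proof.
move=> gI; apply/fsetP => y; rewrite !inE; apply/imfsetP/andP => /=.
  by move=> [z /[!inE] /andP[zx zS] ->]; rewrite (inj_eq gI) in_imfset.
move=> [yx /imfsetP[z /= zS yE]]; exists z => //; rewrite !inE zS andbT.
by apply: contraNneq yx => zx; rewrite yE zx.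
Qed.

Definition swap (x y n : nat) := if n == x then y else if n == y then x else n.

Lemma swapK x y : involutive (swap x y).
Proof.
move=> n; rewrite /swap; have [->|nx] := eqVneq n x.
  by rewrite eqxx; case: eqVneq.
by have [->|ny] := eqVneq n y; rewrite ?eqxx // (negbTE nx) (negbTE ny).
Qed.

Lemma swap_id x y F : x \notin F -> y \notin F -> {in F, swap x y =1 id}.
Proof.
move=> xF yF n nF; rewrite /swap ifN; last by apply: contraNneq xF => <-.
by rewrite ifN //; apply: contraNneq yF => <-.
Qed.

Lemma swapL x y : swap x y x = y.
Proof. by rewrite /swap eqxx. Qed.

Lemma swapR x y : swap x y y = x.
Proof. by rewrite /swap eqxx; case: eqVneq. Qed.

(** * FI-submodules, their exactness, and the unfreezing of letters *)

Section FISubmodules.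
Variables (A : comNzRingType) (P : finType).
Local Notation fn := ({ffun P -> nat} -> A^o).
Implicit Types (W : {fset nat} -> fn -> Prop).

(* An FI-submodule, with the letters in F frozen, of the FI-module sending S to
   the functions supported on the words in S; its maps are extensions by zero *)
Record fi_submodule F W : Prop := FISubmodule {
  fi_mod : forall S, submodule (W S);
  fi_supp : forall S phi e, W S phi -> phi e != 0 -> supp e `<=` S;
  fi_mono : forall S T phi, S `<=` T -> W S phi -> W T phi;
  fi_act : forall S g g' phi, cancel g g' -> cancel g' g ->
    {in F, g =1 id} -> W S phi -> W (g @` S) (phi \o relabel g') }.

(** Surjectivity onto [W S] of the sum of the pieces with one letter of [T] removed: the last place
    of a Koszul-type complex whose terms remove successive letters. *)
Definition exact0 W S T := forall phi, W S phi ->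
  exists2 psi : nat -> fn, (forall t, t \in T -> W (S `\ t) (psi t)) &
    phi = \sum_(t <- T) psi t.

(** Exactness of the same complex one place earlier. The formula antisymmetrizes [eta], so its
    diagonal entries cancel. *)
Definition exact1 W S T := forall psi : nat -> fn,
  (forall t, t \in T -> W (S `\ t) (psi t)) -> \sum_(t <- T) psi t = 0 ->
  exists2 eta : nat -> nat -> fn,
    (forall t s, t \in T -> s \in T -> W (S `\ t `\ s) (eta t s)) &
    forall t, t \in T -> psi t = \sum_(s <- T) (eta t s - eta s t).

Definition eventually_exact F W := exists N, forall S,
  F `<=` S -> (N < #|` S|)%N -> exact0 W S (S `\` F) /\ exact1 W S (S `\` F).

Lemma fi_sub F F' W : F `<=` F' -> fi_submodule F W -> fi_submodule F' W.
Proof.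
move=> /fsubsetP FF' [h1 h2 h3 h4]; split=> // S g g' phi gK g'K gid.
by apply: h4 => // x /FF'; exact: gid.
Qed.

Section Transport.
Variables (F : {fset nat}) (W : {fset nat} -> fn -> Prop).
Hypothesis hW : fi_submodule F W.
Variables (g g' : nat -> nat).
Hypotheses (gK : cancel g g') (g'K : cancel g' g) (gF : {in F, g =1 id}).

Lemma fi_act_inv S phi : W (g @` S) phi -> W S (phi \o relabel g).
Proof.
move=> Wphi; rewrite -[S](imfset_can _ gK); apply: (fi_act hW) => //.
by move=> x xF; rewrite -{1}(gF xF) gK.
Qed.

(** Exactness depends on [S] only up to permutations of the letters fixing [F]. This allows a letter
    of [S] outside [F] to be exchanged for a prescribed one. *)
Lemma exact0_transport S T : exact0 W (g @` S) (g @` T) -> exact0 W S T.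
Proof.
move=> ex phi /(fi_act hW gK g'K gF)/ex[psi psiW phiE].
exists (fun t => psi (g t) \o relabel g) => [t tT|].
  apply: fi_act_inv; rewrite imfsetD1; last exact: can_inj gK.
  by apply: psiW; rewrite in_imfset.
apply/funext => e; have := congr1 (fun f => f (relabel g e)) phiE.
rewrite /= (relabelK gK) => ->; rewrite !fct_sumE.
by rewrite big_imfset //= => x y _ _; exact: (can_inj gK).
Qed.

Lemma exact1_transport S T : exact1 W (g @` S) (g @` T) -> exact1 W S T.
Proof.
have gI := can_inj gK.
have gI2 : {in T &, injective g} by move=> x y _ _; exact: gI.
move=> ex psi psiW psi0.
have [||eta etaW psiE] := ex (fun t => psi (g' t) \o relabel g').
- move=> _ /imfsetP[t /= tT ->]; rewrite gK -imfsetD1 //.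
  by apply: (fi_act hW) => //; exact: psiW.
- rewrite big_imfset //=; apply/funext => e; rewrite fct_sumE.
  have := congr1 (fun f => f (relabel g' e)) psi0; rewrite fct_sumE.
  by apply: etrans; apply: eq_bigr => t _ /=; rewrite gK.
exists (fun t s => eta (g t) (g s) \o relabel g) => [t s tT sT|t tT].
  apply: fi_act_inv; rewrite !imfsetD1 //.
  by apply: etaW; rewrite in_imfset.
have := psiE (g t); rewrite in_imfset // => /(_ isT) /funeqP psitE.
apply/funext => e; have := psitE (relabel g e).
rewrite /= gK (relabelK gK) => ->; rewrite !fct_sumE.
by rewrite big_imfset.
Qed.
End Transport.

Section Cone.
Variables (F : {fset nat}) (W : {fset nat} -> fn -> Prop).
Hypothesis hW : fi_submodule F W.
Variables (S T : {fset nat}) (x : nat).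
Hypothesis xT : x \in T.

Lemma exact0_cone : exact0 W S (T `\ x) -> exact0 W S T.
Proof.
move=> ex phi /ex[psi psiW ->].
exists (fun t => if t == x then 0 else psi t) => [t tT|].
  case: eqVneq => [_|tx]; first exact: submodule0 (fi_mod hW _).
  by apply: psiW; rewrite !inE tx.
rewrite [RHS](big_fsetD1 x) //= eqxx add0r.
by apply: eq_big_seq => t; rewrite !inE => /andP[/negbTE ->].
Qed.

(** The complex for [T] is the mapping cone of the map from the complex on [S] without [x] to the
    one on [S], where both remove only letters of [T] other than [x]. *)
Lemma exact1_cone :
  exact0 W (S `\ x) (T `\ x) -> exact1 W S (T `\ x) -> exact1 W S T.
Proof.
move=> ex0 ex1 psi psiW psi0.
have [rho rhoW psixE] := ex0 _ (psiW x xT).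
have hM U := fi_mod hW U.
(* Splitting [psi x] into the [rho t] and moving each [rho t] to position [t] leaves a relation that
   does not involve [x]. *)
have [||eta etaW psiE] := ex1 (fun t => psi t + rho t).
- move=> t tT; have := tT; rewrite !inE => /andP[_ /psiW ?].
  apply: submoduleD => //; apply: (fi_mono hW _ (rhoW _ tT)).
  by rewrite fsetDDl fsetUC -fsetDDl fsubD1set.
- by rewrite big_split /= -psixE addrC; move: psi0; rewrite (big_fsetD1 x).
exists (fun t s => if t == x then if s == x then 0 else rho s
                   else if s == x then 0 else eta t s).
  move=> t s tT sT; case: eqVneq => [->|tx]; case: eqVneq => [_|sx];
    try exact: submodule0.
  - by apply: rhoW; rewrite !inE sx.
  - by apply: etaW; rewrite !inE ?tx ?sx.
move=> t tT; rewrite [RHS](big_fsetD1 x) //= eqxx.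
have [->|tx] := eqVneq t x.
  rewrite subrr add0r psixE; apply: eq_big_seq => s;
    rewrite !inE => /andP[/negbTE -> _].
  by rewrite subr0.
rewrite sub0r; apply: (addIr (rho t));
  rewrite psiE ?inE ?tx // addrAC addNr add0r.
by apply: eq_big_seq => s; rewrite !inE => /andP[/negbTE -> _].
Qed.
End Cone.

Lemma exists_not_mem F S : (#|` F| < #|` S|)%N ->
  exists2 y, y \in S & y \notin F.
Proof.
move=> lt; apply/fsubsetPn; apply: contraTN lt => /fsubset_leq_card.
by rewrite -leqNgt.
Qed.

Lemma imfset_sub_fix F S g : {in F, g =1 id} -> F `<=` S -> F `<=` g @` S.
Proof.
move=> gF /fsubsetP FS; apply/fsubsetP => x xF; rewrite -(gF _ xF).
by rewrite in_imfset // FS.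
Qed.

Lemma imfsetD_fix F S g : injective g -> {in F, g =1 id} ->
  g @` (S `\` F) = (g @` S) `\` F :> {fset nat}.
Proof.
move=> gI gF; apply/fsetP => y; rewrite !inE; apply/imfsetP/andP => /=.
  move=> [z /[!inE] /andP[zF zS] ->]; rewrite in_imfset //; split=> //.
  by apply: contraNN zF => gzF; rewrite -(gI _ _ (gF _ gzF)).
move=> [yF /imfsetP[z /= zS yE]]; exists z => //; rewrite !inE zS andbT.
by apply: contraNN yF => zF; rewrite yE gF.
Qed.

(** If [x] lies in [S], unfreezing it adds one removable letter, which is the cone situation. The
    general case follows by swapping [x] with a letter of [S] outside [F], which exists once [S] has
    more letters than [F]. *)
Lemma eventually_exact_unfreeze1 F W x : fi_submodule F W -> x \notin F ->
  eventually_exact (x |` F) W -> eventually_exact F W.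
Proof.
move=> hW xF [N hN].
have wlogx (Q : {fset nat} -> Prop) m :
    (forall S y, y \notin F -> Q (swap x y @` S) -> Q S) ->
    (forall S, F `<=` S -> x \in S -> (m < #|` S|)%N -> Q S) ->
    forall S, F `<=` S -> (maxn m #|` F| < #|` S|)%N -> Q S.
  move=> Qswap Qx S FS; rewrite gtn_max => /andP[mS /exists_not_mem[y yS yF]].
  have sI : injective (swap x y) by exact: inv_inj (@swapK x y).
  apply: (Qswap _ y) => //; apply: Qx; rewrite ?card_imfset //.
    exact/imfset_sub_fix/FS/swap_id.
  by rewrite -{1}(swapR x y) in_imfset.
have DE S : S `\` (x |` F) = (S `\` F) `\ x by rewrite fsetDDl fsetUC.
have sub S : F `<=` S -> x \in S -> x |` F `<=` S.
  by move=> FS xS; rewrite fsubUset fsub1set xS.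
have ex0 S : F `<=` S -> (maxn N #|` F| < #|` S|)%N -> exact0 W S (S `\` F).
  move: S; apply: wlogx => [S y yF|S FS xS lt].
    have sF := swap_id xF yF.
    rewrite -imfsetD_fix //; last exact: inv_inj (@swapK x y).
    by apply: (exact0_transport hW) => //; exact: swapK.
  apply: (exact0_cone hW (x := x)); first by rewrite !inE xF.
  by rewrite -DE; apply: (hN _ _ _).1 => //; exact: sub.
(* The successor is there because [exact1_cone] uses [exact0] on [S] without [x]. *)
exists (maxn (maxn N #|` F|).+1 #|` F|) => S FS lt; split.
  by apply: ex0 => //; lia.
move: S FS lt; apply: wlogx => [S y yF|S FS xS lt].
  have sF := swap_id xF yF.
  rewrite -imfsetD_fix //; last exact: inv_inj (@swapK x y).
  by apply: (exact1_transport hW) => //; exact: swapK.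
apply: (exact1_cone hW (x := x)); first by rewrite !inE xF.
- have -> : (S `\` F) `\ x = (S `\ x) `\` F by rewrite !fsetDDl fsetUC.
  apply: ex0; first by rewrite fsubsetD1 FS.
  by rewrite (cardfsD1 x S) xS in lt.
- by rewrite -DE; apply: (hN _ _ _).2; [exact: sub|lia].
Qed.

Lemma eventually_exact_unfreeze F W G : fi_submodule F W -> [disjoint F & G] ->
  eventually_exact (F `|` G) W -> eventually_exact F W.
Proof.
move: {2}(#|` G|) (erefl #|` G|) => n; elim: n G => [|n IHn] G.
  by move=> /cardfs0_eq ->; rewrite fsetU0.
move=> Gn hW FG ex; have [x xG] : exists x, x \in G.
  by apply/fset0Pn; rewrite -cardfs_gt0 Gn.
apply: (IHn (G `\ x)) => //.
- by move: Gn; rewrite (cardfsD1 x) xG => -[].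
- exact: fdisjointWr (fsubD1set _ _) FG.
apply: (@eventually_exact_unfreeze1 _ _ x).
- exact: fi_sub (fsubsetUl _ _) hW.
- rewrite !inE eqxx /= orbF; apply: contraTN FG => xF.
  by apply/fdisjointP => /(_ _ xF); rewrite xG.
- by rewrite fsetUCA fsetD1K.
Qed.
End FISubmodules.

Lemma sum_if_eq (V : nmodType) (I : eqType) (s : seq I) (x : I) (f : I -> V) :
  uniq s ->
  \sum_(i <- s) (if x == i then f i else 0) = if x \in s then f x else 0.
Proof.
move=> us; case: ifPn => xs.
  rewrite (bigD1_seq x) //= eqxx big1 ?addr0 // => i.
  by rewrite eq_sym => /negbTE ->.
rewrite big_seq big1 // => i is_.
by case: eqVneq => // xi; rewrite xi is_ in xs.
Qed.

(** The bijection is a composite of swaps, one for each pair of entries. Each new swap exchanges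
    [g x] and [y], which lie neither in [F] nor among the entries already placed. *)
Lemma extend_bijection F (s s' : seq nat) :
  size s = size s' -> uniq s -> uniq s' ->
  {in s, forall x, x \notin F} -> {in s', forall x, x \notin F} ->
  exists g g', [/\ cancel g g', cancel g' g, {in F, g =1 id} & map g s = s'].
Proof.
elim: s s' => [|x s IHs] [|y s'] //= =>
  [_ _ _ _ _|[ss'] /andP[xs us] /andP[ys us'] sF s'F].
  by exists id, id; split.
have [||g [g' [gK g'K gF gs]]] := IHs _ ss' us us'.
- by move=> z zs; apply: sF; rewrite inE zs orbT.
- by move=> z zs; apply: s'F; rewrite inE zs orbT.
have gI := can_inj gK.
have gxF : g x \notin F.
  apply: contra (sF x (mem_head _ _)) => gxF.
  by rewrite -(gI _ _ (gF _ gxF)).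
have yF : y \notin F := s'F y (mem_head _ _).
have gxs' : g x \notin s' by rewrite -gs mem_map.
exists (swap (g x) y \o g), (g' \o swap (g x) y); split.
- by move=> z /=; rewrite swapK.
- by move=> z /=; rewrite g'K swapK.
- by move=> z zF /=; rewrite (gF _ zF); exact: (swap_id gxF yF zF).
rewrite /= swapL map_comp gs; congr cons; apply: map_id_in => z zs'.
by apply: (@swap_id _ _ [fset t in s']); rewrite in_fset.
Qed.

Lemma exists_fresh F a : exists2 G, [disjoint F & G] & #|` G| = a.
Proof.
elim: a => [|a [G FG Ga]]; first by exists fset0; rewrite ?fdisjointX0 ?cardfs0.
pose U := F `|` G; have [x] : exists x, x \notin U.
  exists (\max_(y <- U) y).+1; apply/negP => xU.
  by have := leq_bigmax_seq (P := xpredT) (F := id) _ xU isT; rewrite ltnn.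
rewrite inE negb_or => /andP[xF xG]; exists (x |` G).
  by rewrite fdisjointXU FG andbT fdisjointX1.
by rewrite cardfsU1 xG Ga.
Qed.

(** * Noetherian stabilization and the induction step *)

Section Stabilization.
Variables (A : comNzRingType) (P : finType).
Hypothesis hA : noetherian A.
Local Notation fn := ({ffun P -> nat} -> A^o).
Variables (F : {fset nat}) (W : {fset nat} -> fn -> Prop).
Hypothesis hW : fi_submodule F W.

Definition stable_at D U := forall S phi, W S phi ->
  exists2 phi', W U phi' & forall e, supp e `<=` F `|` D -> phi e = phi' e.

(** The union of all [W S] is a submodule. Its restrictions to the finitely many words in [F] and
    [D] are spanned by those of finitely many elements, which lie in a common [W U]. *)
Lemma stable_ex D :
  exists G, [disjoint F `|` D & G] /\ stable_at D (F `|` D `|` G).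
Proof.
have hM : submodule (fun phi => exists S, W S phi).
  split; first by exists fset0; exact: submodule0 (fi_mod hW _).
    move=> f f' [S Sf] [S' S'f']; exists (S `|` S').
    apply: (submoduleD (fi_mod hW _)).
      by apply: (fi_mono hW _ Sf); exact: fsubsetUl.
    by apply: (fi_mono hW _ S'f'); exact: fsubsetUr.
  by move=> a f [S Sf]; exists S; exact: (submoduleZ (fi_mod hW _)).
have [l lW hl] := noetherian_restr hA (words P (F `|` D)) hM.
have [U UW] : exists U, forall f, f \in l -> W U f.
  elim: l lW {hl} => [|f l IHl] lW; first by exists fset0.
  have [|U UW] := IHl; first by move=> f' f'l; apply: lW; rewrite inE f'l orbT.
  have [S Sf] := lW f (mem_head _ _); exists (S `|` U) => f'.
  rewrite inE => /predU1P[->|/UW Uf'].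
    by apply: (fi_mono hW _ Sf); exact: fsubsetUl.
  by apply: (fi_mono hW _ Uf'); exact: fsubsetUr.
exists (U `\` (F `|` D)); split.
  by apply/fdisjointP => x xFD; rewrite in_fsetD xFD.
move=> S phi Sphi; have [|phi' phiE phi'W] := hl phi; first by exists S.
exists phi' => [|e eFD]; last by apply: phiE; exact: mem_words.
apply: phi'W; first exact: (fi_mod hW).
move=> f /UW; apply: (fi_mono hW).
apply/fsubsetP => x xU; rewrite !inE xU andbT -orbA.
by case: (x \in F); case: (x \in D).
Qed.

(** By symmetry only the size of [D] matters: a [G0] that works for one [D0] can be carried into any
    large enough [G], so its size is a uniform bound. *)
Lemma stable_uniform d : exists a, forall D G, #|` D| = d -> (a <= #|` G|)%N ->
  [disjoint F & D] -> [disjoint F `|` D & G] -> stable_at D (F `|` D `|` G).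
Proof.
have [[D0 [D0d FD0]]|noD] := pselect (exists D, #|` D| = d /\ [disjoint F & D]);
  last by exists 0%N => D G Dd _ FD; case: noD; exists D.
have [G0 [FDG0 st]] := stable_ex D0.
exists #|` G0| => D G Dd G0G FD FDG S phi Sphi.
have dis U V x : [disjoint U & V] -> x \in V -> x \notin U.
  by move=> UV xV; apply: contraTN xV => xU; exact: (fdisjointP UV).
have disU (U V X : {fset nat}) : [disjoint U `|` V & X] ->
  [disjoint U & X] /\ [disjoint V & X].
  by rewrite fdisjointUX => /andP.
have [FG0 DG0] := disU _ _ _ FDG0; have [FG DG] := disU _ _ _ FDG.
have ucat (U V : {fset nat}) (s : seq nat) : [disjoint U & V] -> uniq s ->
  {subset s <= V} -> uniq (U ++ s).
  move=> UV us sV; rewrite cat_uniq fset_uniq us andbT /=.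
  by apply/hasPn => x /sV; exact: dis.
(* The bijection fixes [F], sends [D0] onto [D] and [G0] onto the first letters of [G]. *)
have [|||||g [g' [gK g'K gF]]] :=
    @extend_bijection F (D0 ++ G0) (D ++ take #|` G0| G).
- by rewrite !size_cat size_takel // D0d Dd.
- exact: ucat DG0 (fset_uniq _) _.
- by apply: ucat DG (take_uniq _ (fset_uniq _)) _ => x /mem_take.
- by move=> x; rewrite mem_cat => /orP[]; exact: dis.
- by move=> x; rewrite mem_cat => /orP[|/mem_take]; exact: dis.
rewrite map_cat => /eqP; rewrite eqseq_cat ?size_map ?D0d ?Dd // =>
  /andP[/eqP gD /eqP gG].
have g'F : {in F, g' =1 id} by move=> x xF; rewrite -{1}(gF _ xF) gK.
have g'D x : x \in D -> g' x \in D0.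
  by rewrite -[x \in D]/(x \in enum_fset D) -gD => /mapP[y yD ->]; rewrite gK.
have gD0 x : x \in D0 -> g x \in D.
  by move=> xD; rewrite -[_ \in D]/(_ \in enum_fset D) -gD map_f.
have gG0 x : x \in G0 -> g x \in G.
  by move=> xG; apply: (@mem_take #|` G0|); rewrite -gG map_f.
have [phi' phi'W phiE] := st _ _ (fi_act hW g'K gK g'F Sphi).
exists (phi' \o relabel g') => [|e eFD].
  apply: (fi_mono hW _ (fi_act hW gK g'K gF phi'W)).
  apply/fsubsetP => _ /imfsetP[x /= + ->];
    rewrite !inE -orbA => /or3P[xF|/gD0 ->|/gG0 ->].
  - by rewrite gF // xF.
  - by rewrite orbT.
  - by rewrite !orbT.
rewrite /= -phiE /= ?(relabelK g'K) // supp_relabel.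
apply/fsubsetP => _ /imfsetP[x /= /(fsubsetP eFD) + ->].
by rewrite !inE => /orP[xF|/g'D ->]; rewrite ?orbT // g'F // xF.
Qed.

Lemma stable_uniform_le k : exists a, forall D G,
  (#|` D| <= k)%N -> (a <= #|` G|)%N ->
  [disjoint F & D] -> [disjoint F `|` D & G] -> stable_at D (F `|` D `|` G).
Proof.
elim: k => [|k [a ha]].
  by have [a ha] := stable_uniform 0; exists a => D G;
    rewrite leqn0 => /eqP /ha; apply.
have [a' ha'] := stable_uniform k.+1; exists (maxn a a') => D G.
rewrite leq_eqVlt geq_max ltnS => /orP[/eqP Dk|Dk] /andP[aG a'G];
  first exact: ha'.
exact: ha.
Qed.

Section Parts.
Variables (k : nat) (G : {fset nat}).
Hypothesis FG : [disjoint F & G].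
Hypothesis hG : forall D, (#|` D| <= k)%N -> [disjoint F & D] ->
  [disjoint F `|` D & G] -> stable_at D (F `|` D `|` G).

(** The component of [phi] of exact support [D] outside [F]. Its values on words meeting [G] are
    left arbitrary. *)
Definition avoid_part (phi : fn) D (phiD : fn) :=
  forall e, [disjoint supp e & G] ->
  phiD e = if supp e `\` F == D then phi e else 0.

(** Inclusion-exclusion over the subsets of [D]: stability gives an element agreeing with [phi] on
    words in [F] and [D], from which the components for proper subsets of [D], known by induction,
    are subtracted. *)
Lemma avoid_part_ex S phi D : W S phi -> (#|` D| <= k)%N ->
  [disjoint F `|` G & D] ->
  exists2 phiD, W (F `|` D `|` G) phiD & avoid_part phi D phiD.
Proof.
move=> Sphi; move: {2}#|` D|.+1 (ltnSn #|` D|) => n;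
  elim: n D => // n IHn D Dn Dk FGD.
have /andP[FD GD] : [disjoint F & D]%fset && [disjoint G & D]%fset.
  by rewrite -fdisjointUX.
have [|phi' phi'W phiE] := hG Dk FD _ Sphi.
  by rewrite fdisjointUX FG fdisjoint_sym.
have sub D' : D' \in fpowerset D `\ D -> D' `<` D.
  by rewrite in_fsetD1 fpowersetE fproperEneq.
have ex D' : exists phiD, D' \in fpowerset D `\ D ->
    W (F `|` D' `|` G) phiD /\ avoid_part phi D' phiD.
  case: (boolP (D' \in _)) => [/sub DD'|_]; last by exists 0.
  have lt := fproper_ltn_card DD'.
  have [||| phiD ? ?] := IHn D'; last by exists phiD.
  - by lia.
  - by lia.
  - by apply: fdisjointWr FGD; exact: fproper_sub.
have [h hP] := choice ex; pose X := fpowerset D `\ D.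
have hX : submodule (W (F `|` D `|` G)) := fi_mod hW _.
exists (phi' - \sum_(D' <- X) h D') => [|e eG].
  apply: submoduleB => //; apply: submodule_sum => // D' D'X.
  apply: (fi_mono hW _ (hP _ D'X).1).
  by apply: fsetSU; apply: fsetUS; apply: fproper_sub; exact: sub.
rewrite !fctE fct_sumE (eq_big_seq _ (fun D' D'X => (hP D' D'X).2 e eG)).
rewrite (sum_if_eq _ (fun=> phi e)) ?fset_uniq // -[_ \in _]/(_ \in X)
  in_fsetD1 fpowersetE.
have [eD|neq] /= := eqVneq (supp e `\` F) D.
  by rewrite subr0 phiE // -fsubDset eD fsubset_refl.
have [sub'|nsub] := boolP (supp e `\` F `<=` D).
  by rewrite phiE -?fsubDset // subrr.
(* By the support condition, a word avoiding [G] where [phi'] is nonzero has all its letters in [F]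
   and [D]. *)
rewrite subr0; apply/eqP; apply: contraNT nsub => /(fi_supp hW phi'W) esub.
rewrite fsubDset; apply/fsubsetP => x xe; have /fsubsetP/(_ x xe) := esub.
by rewrite in_fsetU (negbTE (fdisjointP eG x xe)) orbF.
Qed.

Variable S : {fset nat}.
Hypothesis FGS : F `|` G `<=` S.
Let T := S `\` (F `|` G).
Hypothesis kT : (k < #|` T|)%N.
Hypothesis bound : forall U phi e, W U phi -> phi e != 0 ->
  (#|` supp e `\` F| <= k)%N.

(** The kernel of restriction to words avoiding [G], to which the induction on the number of free
    letters applies. *)
Definition vanish_avoid U (phi : fn) :=
  W U phi /\ forall e, [disjoint supp e & G] -> phi e = 0.

Lemma vanish_avoid_fi : fi_submodule (F `|` G) vanish_avoid.
Proof.
have hM U := fi_mod hW U.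
split=> [U|U phi e [] /(fi_supp hW) + _|U U' phi UU' [Uphi phi0]|].
- split; first by split=> //; exact: submodule0.
    move=> f f' [Uf f0] [Uf' f'0]; split; first exact: submoduleD.
    by move=> e eG; rewrite fctE f0 // f'0 // addr0.
  move=> a f [Uf f0]; split; first exact: submoduleZ.
  by move=> e eG; rewrite fctE f0 // scaler0.
- exact.
- by split=> //; exact: (fi_mono hW UU' Uphi).
move=> U g g' phi gK g'K gF [Uphi phi0].
split; first by apply: (fi_act hW) => // x xF; apply: gF; rewrite inE xF.
move=> e eG; rewrite /= phi0 // supp_relabel;
  apply/fdisjointP => _ /imfsetP[x /= xe ->].
apply: contra (fdisjointP eG x xe) => gxG.
by rewrite -(g'K x) gF // inE gxG orbT.
Qed.

(** A set of at most [k] letters misses a letter of [T]. The choice [td] acts as a contracting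
    homotopy: a component of exact support [D] already lives away from the letter [td D]. *)
Lemma free_letter : exists td : {fset nat} -> nat, forall D, (#|` D| <= k)%N ->
  td D \in T /\ td D \notin D.
Proof.
suff /choice[td tdP] : forall D, exists t,
  (#|` D| <= k)%N -> t \in T /\ t \notin D.
  by exists td.
move=> D; case: (leqP #|` D| k) => [Dk|_]; last by exists 0%N.
by have [|t ? ?] := @exists_not_mem D T; [exact: leq_ltn_trans kT | exists t].
Qed.

Lemma T_disjoint D : D `<=` T -> [disjoint F `|` G & D].
Proof.
move=> /fsubsetP DT; apply/fdisjointP => x xFG; apply: contraL xFG => /DT.
by rewrite in_fsetD => /andP[].
Qed.

Lemma part_sub U D : F `|` G `<=` U -> D `<=` U -> F `|` D `|` G `<=` U.
Proof. by rewrite !fsubUset => /andP[-> ->] ->. Qed.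

Let small_sets : seq {fset nat} := [seq D <- fpowerset T | (#|` D| <= k)%N].

Lemma mem_small_sets D : D \in small_sets = (#|` D| <= k)%N && (D `<=` T).
Proof. by rewrite mem_filter fpowersetE. Qed.

Lemma uniq_small_sets : uniq small_sets.
Proof. by rewrite filter_uniq // fset_uniq. Qed.

Lemma supp_small U phi e : W U phi -> U `<=` S -> [disjoint supp e & G] ->
  phi e != 0 -> supp e `\` F \in small_sets.
Proof.
move=> Uphi US eG phie; rewrite mem_small_sets (bound Uphi phie).
apply/fsubsetP => x; rewrite in_fsetD => /andP[xF xe].
have /fsubsetP/(_ x xe)/(fsubsetP US) xS := fi_supp hW Uphi phie.
by rewrite !inE negb_or xF xS (fdisjointP eG x xe).
Qed.

Lemma parts_ex U phi : W U phi -> exists h : {fset nat} -> fn,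
  forall D, D \in small_sets ->
    W (F `|` D `|` G) (h D) /\ avoid_part phi D (h D).
Proof.
move=> Uphi; suff /choice[h hP] : forall D, exists h, D \in small_sets ->
    W (F `|` D `|` G) h /\ avoid_part phi D h by exists h.
move=> D; case: (boolP (D \in _)) => [|_]; last by exists 0.
rewrite mem_small_sets => /andP[Dk DT].
by have [h ? ?] := avoid_part_ex Uphi Dk (T_disjoint DT); exists h.
Qed.

(** Subtracting from [phi] its components of exact support leaves an element of the kernel, which
    [ex] decomposes. The component for [D] is then put at position [td D]. *)
Lemma exact0_step : exact0 vanish_avoid S T -> exact0 W S T.
Proof.
move=> ex phi Sphi; have hM U := fi_mod hW U.
have [h hP] := parts_ex Sphi; have [td tdP] := free_letter.
have hsub D U : D \in small_sets -> F `|` G `<=` U -> D `<=` U -> W U (h D).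
  by move=> Ds FGU DU; apply: (fi_mono hW _ (hP _ Ds).1); exact: part_sub.
have [|psi psiW phiE] := ex (phi - \sum_(D <- small_sets) h D).
  split=> [|e eG].
    apply: submoduleB => //; apply: submodule_sum => // D Ds; apply: hsub => //.
    move: Ds; rewrite mem_small_sets => /andP[_ DT].
    exact: fsubset_trans DT (fsubsetDl _ _).
  rewrite !fctE fct_sumE (eq_big_seq _ (fun D Ds => (hP D Ds).2 e eG)).
  rewrite (sum_if_eq _ (fun=> phi e)) ?uniq_small_sets //.
  case: ifPn => [_|]; first exact: subrr.
  by rewrite subr0 => es; apply/eqP; apply: contraNT es;
    exact: (supp_small Sphi).
exists (fun t => psi t + \sum_(D <- small_sets) (if td D == t then h D else 0)).
  move=> t tT; apply: submoduleD => //; first exact: (psiW t tT).1.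
  apply: submodule_sum => // D Ds; case: eqP => [tE|_]; last exact: submodule0.
  move: (Ds) tT; rewrite mem_small_sets !inE negb_or =>
    /andP[Dk DT] /andP[/andP[tF tG] tS].
  apply: hsub => //; first by rewrite fsubsetD1 FGS inE negb_or tF tG.
  rewrite fsubsetD1 -tE (tdP D Dk).2 andbT.
  exact: fsubset_trans DT (fsubsetDl _ _).
rewrite big_split /= -phiE exchange_big /= -[LHS](subrK (\sum_(D <- small_sets)
  h D)).
congr (_ + _); apply: eq_big_seq => D; rewrite mem_small_sets => /andP[Dk DT].
by rewrite (sum_if_eq _ (fun=> h D)) ?fset_uniq // -[_ \in _]/(td D \in T)
  (tdP D Dk).1.
Qed.

(** A correction by [eta] first makes every [psi t] vanish on words avoiding [G]; exactness for the
    kernel resolves the rest. *)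
Lemma exact1_step : exact1 vanish_avoid S T -> exact1 W S T.
Proof.
move=> ex psi psiW psi0; have hM U := fi_mod hW U.
have [td tdP] := free_letter.
have /choice[h hP] t : exists h : {fset nat} -> fn, t \in T ->
    forall D, D \in small_sets ->
    W (F `|` D `|` G) (h D) /\ avoid_part (psi t) D (h D).
  case: (boolP (t \in T)) => [/psiW/parts_ex[h hP]|_].
    by exists h.
  by exists (fun=> 0).
(* The part of psi t with exact support D moves to the position of the letter
   td D, which D does not use *)
pose eta t s := \sum_(D <- small_sets)
  (if [&& td D == s, t \notin D & t != s] then h t D else 0).
have etaW t s : t \in T -> s \in T -> W (S `\ t `\ s) (eta t s).
  move=> tT sT; apply: submodule_sum => // D Ds.
  case: ifPn => [/and3P[/eqP tds tD ts]|_]; last exact: submodule0.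
  apply: (fi_mono hW _ (hP t tT D Ds).1).
  move: Ds tT sT; rewrite mem_small_sets !inE !negb_or.
  move=> /andP[Dk DT] /andP[/andP[tF tG] tS] /andP[/andP[sF sG] sS].
  have sD : s \notin D by rewrite -tds; exact: (tdP D Dk).2.
  apply: part_sub.
    by rewrite !fsubsetD1 FGS !inE !negb_or tF tG sF sG.
  by rewrite !fsubsetD1 tD sD (fsubset_trans DT (fsubsetDl _ _)).
(* On a word avoiding [G] only the component for its own exact support contributes, so row [t] of
   [eta] has at most one nonzero entry there. *)
have etaE t s e : t \in T -> [disjoint supp e & G] ->
    eta t s e = if (td (supp e `\` F) == s) && (t != s) then psi t e else 0.
  move=> tT eG; rewrite /eta fct_sumE; pose D0 := supp e `\` F.
  transitivity (\sum_(D <- small_sets) (if D0 == D then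
      if [&& td D == s, t \notin D & t != s] then psi t e else 0 else 0)).
    apply: eq_big_seq => D Ds; rewrite -[LHS]/((if _ then h t D else 0) e).
    case: ifP => _; last by case: ifP.
    exact: (hP t tT D Ds).2.
  rewrite (sum_if_eq _ (fun D =>
    if [&& td D == s, t \notin D & t != s] then psi t e else 0))
    ?uniq_small_sets //.
  have [psite|psite] := eqVneq (psi t e) 0; first by rewrite psite !if_same.
  rewrite (supp_small (psiW t tT)) ?fsubD1set //.
  suff -> : t \notin D0 by [].
  rewrite in_fsetD negb_and; apply/orP; right.
  have := fi_supp hW (psiW t tT) psite.
  by rewrite fsubsetD1 => /andP[].
have [|| eta' eta'W psiE] := ex (fun t =>
  psi t - \sum_(s <- T) (eta t s - eta s t)).
- move=> t tT; split=> [|e eG].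
    apply: submoduleB; [by []|exact: psiW|].
    apply: submodule_sum => // s sT; apply: submoduleB => //.
      by apply: (fi_mono hW _ (etaW t s tT sT)); exact: fsubD1set.
    apply: (fi_mono hW _ (etaW s t sT tT)).
    by rewrite fsetDDl fsetUC -fsetDDl fsubD1set.
  have psi0e : \sum_(s <- T) psi s e = 0.
    by have := congr1 (fun f => f e) psi0; rewrite fct_sumE.
  rewrite !fctE fct_sumE.
  have -> : \sum_(s <- T) (eta t s - eta s t) e =
      \sum_(s <- T) (eta t s e - eta s t e) by [].
  rewrite big_split sumrN /=.
  rewrite (eq_bigr _ (fun s _ => etaE t s e tT eG)).
  rewrite (eq_big_seq _ (fun s sT => etaE s t e sT eG)).
  (* By [bound], every [psi s] vanishes on a word with more than [k] letters outside [F]. *)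
  have [Dk|Dk] := leqP #|` supp e `\` F| k; last first.
    have psise s : s \in T -> psi s e = 0.
      move=> sT; apply/eqP; apply: contraLR Dk => /(bound (psiW s sT)).
      by rewrite -leqNgt.
    rewrite psise // !big_seq !big1 ?subrr ?subr0 // => s sT;
      last by rewrite if_same.
    by rewrite psise // if_same.
  have := (tdP _ Dk).1; set d := td _ => dT.
  have -> : \sum_(s <- T) (if (d == s) && (t != s) then psi t e else 0) =
      if t != d then psi t e else 0.
    transitivity (if d \in T then if t != d then psi t e else 0 else 0);
      last by rewrite dT.
    rewrite -(sum_if_eq d (fun s =>
      if t != s then psi t e else 0)) ?fset_uniq //.
    by apply: eq_bigr => s _; case: (d == s).
  (* If [t] is not [d], the row sum of [eta] is [psi t e] and the column sum is zero. If [t] is [d],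
     the row sum is zero and the column sum collects the other [psi s e], so the relation [psi0e]
     concludes. *)
  have [td'|td'] /= := eqVneq t d; last first.
    by rewrite big1 ?subr0 ?subrr.
  move: psi0e; rewrite !(big_fsetD1 t tT) eqxx /= !add0r opprK.
  apply: etrans; congr (_ + _); apply: eq_big_seq => s;
    rewrite !inE => /andP[st _].
  by rewrite st.
- rewrite sumrB psi0 sub0r; apply/eqP; rewrite oppr_eq0; apply/eqP.
  under eq_bigr do rewrite sumrB.
  by rewrite sumrB [X in _ - X]exchange_big subrr.
exists (fun t s => eta' t s + eta t s) => [t s tT sT|t tT].
  by apply: submoduleD => //; [exact: (eta'W t s tT sT).1 | exact: etaW].
apply: etrans (esym (subrK (\sum_(s <- T) (eta t s - eta s t)) _)) _.
rewrite psiE // -big_split; apply: eq_bigr => s _ /=.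
by rewrite opprD addrACA.
Qed.
End Parts.
End Stabilization.

Theorem eventually_exact_fi (A : comNzRingType) (P : finType)
    (F : {fset nat}) (W : {fset nat} -> ({ffun P -> nat} -> A^o) -> Prop) :
  noetherian A -> fi_submodule F W -> eventually_exact F W.
Proof.
move=> hA; have : forall U phi e, W U phi -> phi e != 0 ->
    (#|` supp e `\` F| < #|P|.+1)%N.
  move=> U phi e _ _; rewrite ltnS; apply: leq_trans (card_supp e).
  exact/fsubset_leq_card/fsubsetDl.
(* The induction is on a strict bound for the number of letters outside [F] in words where an
   element is nonzero; the bound 0 forces [W] to vanish. *)
elim: _.+1 F W => [|k IHk] F W bound hW.
  have W0 U phi : W U phi -> phi = 0.
    move=> Uphi; apply/funext => e; apply/eqP; apply: contraTT isT => /eqP.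
    by move/eqP/(bound _ _ _ Uphi).
  have hM U := fi_mod hW U.
  exists 0%N => S _ _; split=> [phi /W0 ->|psi psiW _].
    exists (fun=> 0) => [t _|]; first exact: submodule0.
    by rewrite big1.
  exists (fun _ _ => 0) => [t s _ _|t /psiW/W0 ->]; first exact: submodule0.
  by rewrite big1 // => s _; rewrite subr0.
have [a ha] := stable_uniform_le hA hW k.
have [G FG Ga] := exists_fresh F a.
apply: (eventually_exact_unfreeze hW FG).
have hG D : (#|` D| <= k)%N -> [disjoint F & D] -> [disjoint F `|` D & G] ->
    stable_at F W D (F `|` D `|` G).
  by move=> Dk; apply: ha => //; rewrite Ga.
have [||N hN] := IHk (F `|` G) (vanish_avoid W G).
(* Elements of the kernel live on words meeting [G]. As [G] is disjoint from [F], freezing it lowers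
   the number of free letters. *)
- move=> U phi e [Uphi phi0] phie.
  rewrite -ltnS; apply: leq_trans (bound _ _ _ Uphi phie).
  rewrite ltnS; apply: fproper_ltn_card.
  have ndis : ~~ [disjoint supp e & G]%fset.
    by apply: contraNN phie => /phi0 ->.
  rewrite fproperE fsetDS ?fsubsetUl //=; apply: contra ndis => sub.
  apply/fdisjointP => x xe; apply/negP => xG.
  have := fsubsetP sub x; rewrite !inE xG xe orbT andbT.
  by rewrite (fdisjointP_sym FG x xG) => /(_ isT).
- exact: vanish_avoid_fi.
(* The second bound leaves more than [k] letters outside [F] and [G], as the choice of [td]
   requires. *)
exists (maxn N (k + #|` F `|` G|)) => S FGS; rewrite gtn_max => /andP[NS kS].
have kT : (k < #|` S `\` (F `|` G)|)%N by rewrite cardfsDS //; lia.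
have [ex0 ex1] := hN S FGS NS.
have bd U phi e : W U phi -> phi e != 0 -> (#|` supp e `\` F| <= k)%N.
  by move=> /bound h /h.
split; first exact: (exact0_step hW FG hG FGS kT bd ex0).
exact: (exact1_step hW FG hG FGS kT bd ex1).
Qed.

(** * Duals of coinvariants as functions on words *)

Section Monomials.
Variables (A : comNzRingType) (I : finType).
Local Notation poly := {malg A[{cmonom I}]}.

(* Fixes one elaboration of [<< m >>]: different paths through the ring
   hierarchy of A make unification diverge *)
Definition monom (m : {cmonom I}) : poly := << m >>.

Lemma monomM m m' : monom m * monom m' = monom (mmul m m').
Proof. by rewrite /monom malgM_def fgmulUU mulr1. Qed.

Lemma monom1 : monom mone = 1. Proof. by []. Qed.

Lemma monomZ (c : A) m : c *: monom m = << c *g m >>.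
Proof. by rewrite -mul_malgC /monom malgM_def fgmulUU mulr1 mul1m. Qed.

Lemma monomX (k : I) n : exists2 m : {cmonom I},
  monom (ucm k) ^+ n = monom m & forall j, m j = ((k == j) * n)%N.
Proof.
elim: n => [|n [m mE hm]].
  by exists mone => [|j]; [rewrite expr0 | rewrite muln0 cm1].
exists (mmul (ucm k) m) => [|j]; first by rewrite exprS mE; exact: monomM.
by rewrite cmM cmU hm mulnS.
Qed.

Lemma monom_prod (m : {cmonom I}) : monom m = \prod_k monom (ucm k) ^+ m k.
Proof.
have [m' -> hm'] : exists2 m' : {cmonom I},
    \prod_k monom (ucm k) ^+ m k = monom m' &
    forall j, m' j = (\sum_k (k == j) * m k)%N.
  elim: (index_enum I) => [|k s [m' mE hm']].
    by exists mone => [|j]; [rewrite big_nil monom1 | rewrite big_nil cm1].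
  have [mk mkE hmk] := monomX k (m k); exists (mmul mk m') => [|j].
    by rewrite big_cons mE mkE; exact: monomM.
  by rewrite cmM big_cons hmk hm'.
congr monom; apply/eqP/cmP => j.
rewrite hm' (bigD1 j) //= eqxx mul1n big1 ?addn0 // => k /negbTE ->.
by rewrite mul0n.
Qed.
End Monomials.

Section Evaluation.
Variables (A : comNzRingType) (r : nat) (J : 'I_r -> nat).
Local Notation poly S := {malg A[{cmonom ('I_r * S)%type}]}.
Local Notation slot := {i : 'I_r & 'I_(J i)}.
Local Notation word := {ffun slot -> nat}.

Section Letters.
Variables (S : finType) (f : S -> nat).

(** The value zero outside the image of [f] makes pullback along an injection send letters to
    letters. *)
Definition letter (i : 'I_r) (t : nat) : poly S :=
  if [pick s | f s == t] is Some s then monom A (ucm (i, s)) else 0.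

Definition word_poly (e : word) : poly S := \prod_p letter (tag p) (e p).

Lemma letter_im i s : injective f -> letter i (f s) = monom A (ucm (i, s)).
Proof.
move=> f_inj; rewrite /letter; case: pickP => [s' /eqP /f_inj -> //|/(_ s)].
by rewrite eqxx.
Qed.

Lemma letter_homog i t : multihomog (fun j => (i == j) : nat) (letter i t).
Proof.
rewrite /letter; case: pickP => [s _|_]; last exact: multihomog0.
move=> m; rewrite msuppU1 in_fset1 => /eqP -> j.
rewrite (bigD1 s) //= big1 ?addn0 => [|t' /negbTE ts].
  by rewrite cmU xpair_eqE eqxx andbT.
by rewrite cmU xpair_eqE [s == t']eq_sym ts andbF.
Qed.

Lemma word_poly_homog e : multihomog J (word_poly e).
Proof.
have := multihomog_prod (fun p : slot => @letter_homog (tag p) (e p)).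
move/eq_multihomog; apply=> i.
rewrite -(sig_big_dep xpredT (fun=> xpredT) (fun j _ => (j == i) : nat)) /=.
rewrite (bigD1 i) //= [X in (_ + X)%N]big1 ?addn0 => [|j /negbTE ->];
  last by rewrite big1.
by rewrite eqxx sum1_card card_ord.
Qed.

Lemma homog_class_proof p : multihomog J p ->
  lquot_pi (@coinv_ideal A r S) p \in @coinv_piece A r J S.
Proof. by move=> pJ; apply/asboolP; exists p. Qed.

Definition homog_class p (pJ : multihomog J p) : Rgraded A J S :=
  MkRgraded (homog_class_proof pJ).

Definition word_class e := homog_class (@word_poly_homog e).

Definition eval (psi : dual (Rgraded A J S)) : word -> A^o :=
  fun e => psi (word_class e).

(** The [J i] slots of index [i] are filled with the second indices of the generators in [m],
    repeated according to multiplicity. *)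
Lemma monom_word (m : {cmonom ('I_r * S)%type}) : injective f ->
  (forall i, (\sum_(t : S) m (i, t))%N = J i) ->
  exists e, word_poly e = monom A m.
Proof.
move=> f_inj mJ.
pose s i := flatten [seq nseq (m (i, t)) t | t <- index_enum S].
have size_s i : size (s i) = J i.
  rewrite size_flatten /shape -map_comp sumnE big_map -mJ.
  by apply: eq_bigr => t _ /=; rewrite size_nseq.
(* The default 0 is never reached, since [s i] has length [J i]. *)
exists [ffun p : slot => nth 0%N (map f (s (tag p))) (tagged p)].
rewrite monom_prod /word_poly.
under eq_bigr do rewrite ffunE.
rewrite -(sig_big_dep xpredT (fun=> xpredT)
  (fun i (j : 'I_(J i)) => letter i (nth 0%N (map f (s i)) j))) /=.
rewrite [RHS](eq_bigr (fun it =>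
  monom A (ucm (it.1, it.2)) ^+ m (it.1, it.2))); last by case.
rewrite -[RHS](pair_bigA _ (fun i t => monom A (ucm (i, t)) ^+ m (i, t))) /=.
apply: eq_bigr => i _.
rewrite -(big_mkord xpredT (fun j => letter i (nth 0%N (map f (s i)) j))).
rewrite -(size_s i) -(size_map f) -(big_nth 0%N xpredT (letter i)) big_map.
rewrite big_flatten big_map; apply: eq_bigr => t _.
by rewrite big_nseq -Monoid.iteropE letter_im.
Qed.

(** The classes of words span the graded piece, since every monomial of multidegree [J] is a word
    monomial. *)
Lemma eval_inj psi : injective f -> eval psi = 0 -> psi = 0.
Proof.
move=> f_inj psi0; apply: dualP => -[q qP]; rewrite /dual_app.
have /asboolP[p pJ pq] := qP.
have hm (m : {cmonom ('I_r * S)%type}) : exists e,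
  m \in msupp p -> word_poly e = monom A m.
  case: (boolP (m \in msupp p)) => [/pJ/(monom_word f_inj)[e ?]|_];
    first by exists e.
  by exists [ffun=> 0%N].
have [e he] := choice hm.
have -> : MkRgraded qP = \sum_(m <- msupp p) p@_m *: word_class (e m).
  apply: val_inj; rewrite raddf_sum /= -pq {1}[p]monalgE linear_sum.
  apply: eq_big_seq => m mp; rewrite he // -linearZ; congr lquot_pi.
  by rewrite monomZ.
rewrite linear_sum big1 // => m _; rewrite linearZ /=.
have /funeqP/(_ (e m)) := psi0; rewrite /eval /dual_app => ->.
exact: scaler0.
Qed.

End Letters.
End Evaluation.

Section Naturality.
Variables (A : comNzRingType) (r : nat) (J : 'I_r -> nat).
Local Notation slot := {i : 'I_r & 'I_(J i)}.
Local Notation word := {ffun slot -> nat}.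
Local Notation fn := (word -> A^o).

Section Map.
Variables (S S' : finType) (f : S -> nat) (f' : S' -> nat) (h : S -> S').
Hypotheses (f'_inj : injective f') (h_inj : injective h).
Hypothesis f'h : forall s, f' (h s) = f s.

Lemma pull_letter (i : 'I_r) t : pull h (letter A f' i t) = letter A f i t.
Proof.
rewrite [in LHS]/letter; case: pickP => [s' /eqP <-|ns'].
  rewrite [LHS]psubstX /pullX /letter /=.
  suff /eq_pick -> : (fun s => h s == s') =1 (fun s => f s == f' s') by [].
  by move=> s /=; rewrite -f'h (inj_eq f'_inj).
rewrite rmorph0 /letter; case: pickP => // s.
by rewrite -f'h ns'.
Qed.

Lemma Rpull_word_class (e : word) :
  Rpull h_inj (word_class A f' e) = word_class A f e.
Proof.
apply: val_inj; apply: etrans (coinv_pullE _ _) _.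
congr lquot_pi; rewrite /word_poly rmorph_prod.
by apply: eq_bigr => p _; exact: pull_letter.
Qed.

(** The maps between duals thus become inclusions of spaces of functions on words. *)
Lemma eval_dual_map (psi : dual (Rgraded A J S)) :
  eval f' (dual_map (Rpull h_inj (J := J)) psi) = eval f psi.
Proof.
by apply/funext => e; rewrite /eval -Rpull_word_class.
Qed.
End Map.

Lemma evalD (S : finType) (f : S -> nat) (psi psi' : dual (Rgraded A J S)) :
  eval f (psi + psi') = eval f psi + eval f psi'.
Proof. by []. Qed.

Lemma evalZ (S : finType) (f : S -> nat) a (psi : dual (Rgraded A J S)) :
  eval f (a *: psi) = a *: eval f psi.
Proof. by []. Qed.

Lemma eval0 (S : finType) (f : S -> nat) :
  eval f (0 : dual (Rgraded A J S)) = 0.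
Proof. by []. Qed.

(** The domain [S] and its embedding are existential, so that enlarging [T] keeps the witness and
    relabelling only changes the embedding. *)
Definition dual_eval T (phi : fn) := exists (S : finType) (f : S -> nat)
  (psi : dual (Rgraded A J S)),
  [/\ injective f, forall s, f s \in T & phi = eval f psi].

(** The domain of a witness embeds into any [S] whose letters cover [T], and the functional is
    pushed forward. This puts several elements on a common domain. *)
Lemma dual_eval_onto T (S : finType) (f : S -> nat) phi : injective f ->
  (forall t, t \in T -> exists s, f s = t) -> dual_eval T phi ->
  exists psi, phi = eval f psi.
Proof.
move=> f_inj fT [S' [f' [psi [f'_inj f'T ->]]]].
have /choice[h hE] s' : exists s, f s = f' s' by exact: fT.
have h_inj : injective h by move=> x y hxy; apply: f'_inj; rewrite -!hE hxy.
by exists (dual_map (Rpull h_inj (J := J)) psi);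
  rewrite (eval_dual_map f_inj h_inj hE).
Qed.

Lemma letter_out (S : finType) (f : S -> nat) (i : 'I_r) t :
  (forall s, f s != t) -> letter A f i t = 0.
Proof.
by move=> ft; rewrite /letter; case: pickP => // s; rewrite (negbTE (ft s)).
Qed.

Lemma dual_eval_fi : fi_submodule fset0 dual_eval.
Proof.
split=> [T|T phi e [S [f [psi [f_inj fT ->]]]]|T T' phi /fsubsetP TT'|].
- have onto t : t \in T -> exists s : T, val s = t by move=> tT; exists [` tT].
  have in_T (psi : dual (Rgraded A J T)) : dual_eval T (eval val psi).
    by exists T, val, psi; split=> //; exact: fsvalP.
  split; first by rewrite -(eval0 (val : T -> nat)).
    move=> phi phi' /(dual_eval_onto val_inj onto)[psi ->].
    by move=> /(dual_eval_onto val_inj onto)[psi' ->]; rewrite -evalD.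
  by move=> a _ /(dual_eval_onto val_inj onto)[psi ->]; rewrite -evalZ.
(* A letter outside the image of [f] is sent to zero, so the word has zero class. *)
- move=> nz; apply/supp_subP => p; apply: contraR nz => epT; apply/eqP.
  rewrite /eval; suff -> : word_class A f e = 0 by exact: linear0.
  apply: val_inj; rewrite /= /word_poly (bigD1 p) //=.
  rewrite letter_out ?mul0r ?linear0 //.
  by move=> s; apply: contraNneq epT => <-.
- move=> [S [f [psi [f_inj fT ->]]]]; exists S, f, psi; split=> // s.
  exact: TT'.
move=> T g g' phi gK g'K _ [S [f [psi [f_inj fT ->]]]].
exists S, (g \o f), psi; split.
- by apply: inj_comp f_inj; exact: can_inj gK.
- by move=> s; rewrite /= in_imfset /=.
apply/funext => e; rewrite /eval /=; congr (dual_app psi _);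
  apply: val_inj => /=.
congr lquot_pi; apply: eq_bigr => p _; rewrite ffunE /letter.
suff /eq_pick -> :
  (fun s => f s == g' (e p)) =1 (fun s => g (f s) == e p) by [].
by move=> s; rewrite (can2_eq gK g'K).
Qed.
End Naturality.

(** * From exactness to the colimit *)

Section Gluing.
Variables (A : comNzRingType) (P : finType).
Local Notation fn := ({ffun P -> nat} -> A^o).
Variables (W : {fset nat} -> fn -> Prop) (N : nat).
Hypothesis hW : fi_submodule fset0 W.
Hypothesis W_exact : forall S, (N < #|` S|)%N -> exact0 W S S /\ exact1 W S S.
Variables (C : zmodType) (R : {fset nat}).
Variable graph : {fset nat} -> fn -> C -> Prop.
(* For small U, graph U is the graph of the structure map from W U to C; glued U
   is its extension to all U *)
Hypothesis graph_small : forall U phi c, graph U phi c -> (#|` U| <= N)%N.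
Hypothesis graph_dom : forall U phi c, graph U phi c -> W U phi.
Hypothesis graphB : forall U phi c psi d,
  graph U phi c -> graph U psi d -> graph U (phi - psi) (c - d).
Hypothesis graph_mono : forall U T phi c, U `<=` T -> (#|` T| <= N)%N ->
  graph U phi c -> graph T phi c.
Hypothesis graph_fun : forall U c, graph U 0 c -> c = 0.
Hypothesis graph_total : forall U phi, U `<=` R -> (#|` U| <= N)%N -> W U phi ->
  exists c, graph U phi c.

Inductive glued U : fn -> C -> Prop :=
| glued0 : glued U 0 0
| gluedS T phi c psi d : T `<=` U -> graph T phi c -> glued U psi d ->
    glued U (phi + psi) (c + d).

Lemma glued_graph U T phi c : T `<=` U -> graph T phi c -> glued U phi c.
Proof.
by move=> TU h; rewrite -[phi]addr0 -[c]addr0; apply: gluedS h (glued0 _).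
Qed.

Lemma gluedD U phi c psi d : glued U phi c -> glued U psi d ->
  glued U (phi + psi) (c + d).
Proof.
move=> h hpsi; elim: h => [|T phi' c' psi' d' TU hT _ IH];
  first by rewrite !add0r.
by rewrite -!addrA; apply: gluedS hT IH.
Qed.

Lemma gluedN U phi c : glued U phi c -> glued U (- phi) (- c).
Proof.
elim=> [|T phi' c' psi' d' TU hT _ IH]; first by rewrite !oppr0; exact: glued0.
rewrite !opprD; apply: gluedS TU _ IH; have := graphB (graphB hT hT) hT.
by rewrite !subrr !sub0r.
Qed.

Lemma gluedB U phi c psi d : glued U phi c -> glued U psi d ->
  glued U (phi - psi) (c - d).
Proof. by move=> h h'; apply: gluedD (gluedN h'). Qed.

Lemma glued_sum U (I : eqType) (s : seq I) (phi : I -> fn) (c : I -> C) :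
  (forall i, i \in s -> glued U (phi i) (c i)) ->
  glued U (\sum_(i <- s) phi i) (\sum_(i <- s) c i).
Proof.
elim: s => [|i s IHs] h; first by rewrite !big_nil; exact: glued0.
rewrite !big_cons; apply: gluedD; first exact: (h _ (mem_head _ _)).
by apply: IHs => j js; apply: h; rewrite inE js orbT.
Qed.

Lemma glued_mono U T phi c : U `<=` T -> glued U phi c -> glued T phi c.
Proof.
move=> UT; elim=> [|V phi' c' psi' d' VU hV _ IH]; first exact: glued0.
by apply: gluedS hV IH; exact: fsubset_trans UT.
Qed.

Lemma glued_dom U phi c : glued U phi c -> W U phi.
Proof.
elim=> [|T phi' c' psi' d' TU hT _ IH]; first exact: submodule0 (fi_mod hW U).
by apply: (submoduleD (fi_mod hW U)) IH; apply: (fi_mono hW TU);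
  exact: graph_dom hT.
Qed.

(** By strong induction on the size: [exact0] writes an element over a large [U] as a sum of
    elements over smaller sets. *)
Lemma glued_total U phi : U `<=` R -> W U phi -> exists c, glued U phi c.
Proof.
move: {2}#|` U|.+1 (ltnSn #|` U|) => n;
  elim: n U phi => // n IHn U phi Un UR Uphi.
have [UN|NU] := leqP #|` U| N.
  have [c h] := graph_total UR UN Uphi; exists c; exact: glued_graph h.
have [psi psiW ->] := (W_exact NU).1 phi Uphi.
have ex t : exists c, t \in U -> glued (U `\ t) (psi t) c.
  case: (boolP (t \in U)) => [tU|_]; last by exists 0.
  have [||c h] := IHn (U `\ t) (psi t) _ _ (psiW t tU); last by exists c.
    by move: Un; rewrite (cardfsD1 t) tU.
  exact: fsubset_trans (fsubD1set _ _) UR.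
have [c hc] := choice ex; exists (\sum_(t <- U) c t); apply: glued_sum => t tU.
by apply: glued_mono (hc t tU); exact: fsubD1set.
Qed.

Lemma glued_small U phi c : (#|` U| <= N)%N -> U `<=` R -> glued U phi c ->
  graph U phi c.
Proof.
move=> UN UR; elim=> [|T phi' c' psi' d' TU hT _ IH].
  have [c0 h] := graph_total UR UN (submodule0 (fi_mod hW U)).
  by rewrite -(graph_fun h).
have {}hT := graph_mono TU UN hT.
have := graphB hT (graphB (graphB hT hT) IH).
by rewrite !subrr !sub0r !opprK.
Qed.

(** Each small set in the gluing has fewer letters than [U], so it misses some letter [t] of [U];
    its term is assigned to position [t]. *)
Lemma glued_split U phi c : (N < #|` U|)%N -> glued U phi c ->
  exists (psi : nat -> fn) (d : nat -> C),
  [/\ forall t, t \in U -> glued (U `\ t) (psi t) (d t),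
      \sum_(t <- U) psi t = phi & \sum_(t <- U) d t = c].
Proof.
move=> NU; elim=> [|T phi' c' psi' d' TU hT _ [psi [d [h <- <-]]]].
  exists (fun=> 0), (fun=> 0); split=> [t _||];
    [exact: glued0|exact: big1|exact: big1].
have [|t tU tT] := @exists_not_mem T U;
  first exact: leq_ltn_trans (graph_small hT) NU.
exists (fun s => (if t == s then phi' else 0) + psi s).
exists (fun s => (if t == s then c' else 0) + d s); split=> [s sU||].
- apply: gluedD (h s sU); case: eqVneq => [<-|_]; last exact: glued0.
  by apply: (glued_graph _ hT); rewrite fsubsetD1 TU.
- by rewrite big_split /= (sum_if_eq t (fun=> phi')) ?fset_uniq // tU.
- by rewrite big_split /= (sum_if_eq t (fun=> c')) ?fset_uniq // tU.
Qed.

(** By [exact1], the relation between the [psi t] comes from elements over [U] minus two letters,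
    with values [b]. By induction on the size each [d t] is the corresponding sum of differences,
    and the total cancels by antisymmetry. *)
Lemma glued_fun U c : U `<=` R -> glued U 0 c -> c = 0.
Proof.
move: {2}#|` U|.+1 (ltnSn #|` U|) => n; elim: n U c => // n IHn U c Un UR h.
have [UN|NU] := leqP #|` U| N; first exact: graph_fun (glued_small UN UR h).
have [psi [d [hpsi psi0 <-]]] := glued_split NU h.
have [|eta etaW psiE] := (W_exact NU).2 psi _ psi0.
  by move=> t tU; exact: glued_dom (hpsi t tU).
have subUts t s : U `\ t `\ s `<=` R.
  apply: fsubset_trans (fsubD1set _ _) _.
  exact: fsubset_trans (fsubD1set _ _) UR.
have ex (ts : nat * nat) : exists c, ts.1 \in U -> ts.2 \in U ->
    glued (U `\ ts.1 `\ ts.2) (eta ts.1 ts.2) c.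
  case: (boolP (ts.1 \in U)) => [tU|_]; last by exists 0.
  case: (boolP (ts.2 \in U)) => [sU|_]; last by exists 0.
  by have [c' h'] := glued_total (subUts _ _) (etaW _ _ tU sU); exists c'.
have [b hb] := choice ex.
have dE t : t \in U -> d t = \sum_(s <- U) (b (t, s) - b (s, t)).
  move=> tU; apply/eqP; rewrite -subr_eq0; apply/eqP; apply: (IHn (U `\ t)).
  - by move: Un; rewrite (cardfsD1 t) tU.
  - exact: fsubset_trans (fsubD1set _ _) UR.
  rewrite -(subrr (psi t)) {2}psiE //; apply: gluedB (hpsi t tU) _.
  apply: glued_sum => s sU; apply: gluedB.
    by apply: glued_mono (hb (t, s) tU sU); exact: fsubD1set.
  apply: glued_mono (hb (s, t) sU tU).
  by rewrite /= fsetDDl fsetUC -fsetDDl fsubD1set.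
rewrite (eq_big_seq _ dE); under eq_bigr do rewrite sumrB.
by rewrite sumrB [X in _ - X]exchange_big subrr.
Qed.
End Gluing.

(** * The colimit over small subsets of a finite set *)

Section SmallSubsets.
Variables (A : comNzRingType) (r : nat) (J : 'I_r -> nat) (n N : nat).
Local Notation slot := {i : 'I_r & 'I_(J i)}.
Local Notation fn := ({ffun slot -> nat} -> A^o).
Local Notation C := (colim (@small_map A r J n N)).
Local Notation to_colim S := (colim_in (@small_map A r J n N) S).

Definition ord_set U : {set 'I_n} := [set i : 'I_n | val i \in U]%SET.

Lemma card_ord_set U : (#|ord_set U| <= #|` U|)%N.
Proof.
rewrite cardE -(size_map val); apply: uniq_leq_size.
  by rewrite (map_inj_uniq val_inj) enum_uniq.
by move=> _ /mapP[i + ->]; rewrite mem_enum inE.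
Qed.

Definition small_ord_set U (hU : (#|` U| <= N)%N) : small_set n N :=
  exist _ (ord_set U) (leq_trans (card_ord_set U) hU).

Definition sub_val (S : {set 'I_n}) (x : {x | x \in S}) : nat := val (val x).

Lemma sub_val_inj (S : {set 'I_n}) : injective (@sub_val S).
Proof. by move=> x y /val_inj/val_inj. Qed.

Lemma eval_small_map (S S' : small_set n N) (SS' : small_le S S')
    (psi : small_dual A J S) :
  eval (@sub_val (val S')) (small_map A J SS' psi) =
  eval (@sub_val (val S)) psi.
Proof. by apply: eval_dual_map; first exact: sub_val_inj. Qed.

Lemma eval_small_to_full (S : small_set n N) (psi : small_dual A J S) :
  eval val (small_to_full A J S psi) = eval (@sub_val (val S)) psi.
Proof. by apply: eval_dual_map; first exact: val_inj. Qed.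

(** The size bound is part of the witness because the indices of the diagram carry it. *)
Definition colim_graph U (phi : fn) (c : C) :=
  exists (hU : (#|` U| <= N)%N) (psi : small_dual A J (small_ord_set hU)),
    phi = eval (@sub_val (ord_set U)) psi /\
    c = to_colim (small_ord_set hU) psi.

Definition ord_range : {fset nat} := [fset val i | i : 'I_n].

Lemma colim_graph_small U phi c : colim_graph U phi c -> (#|` U| <= N)%N.
Proof. by case. Qed.

Lemma colim_graph_dom U phi c : colim_graph U phi c -> dual_eval U phi.
Proof.
move=> [hU [psi [-> _]]].
exists {x | x \in ord_set U}, (@sub_val (ord_set U)), psi; split=> //.
  exact: sub_val_inj.
by move=> x; have := valP x; rewrite /= inE.
Qed.

Lemma colim_graphB U phi c phi' c' :
  colim_graph U phi c -> colim_graph U phi' c' ->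
  colim_graph U (phi - phi') (c - c').
Proof.
move=> [hU [psi [-> ->]]] [hU' [psi' [-> ->]]].
rewrite (bool_irrelevance hU' hU) in psi' *.
by exists hU, (psi - psi'); rewrite linearB.
Qed.

Lemma colim_graph_mono U T phi c : U `<=` T -> (#|` T| <= N)%N ->
  colim_graph U phi c -> colim_graph T phi c.
Proof.
move=> /fsubsetP UT hT [hU [psi [-> ->]]].
have le : small_le (small_ord_set hU) (small_ord_set hT).
  by apply/subsetP => i; rewrite !inE; exact: UT.
exists hT, (small_map A J le psi); split; first exact/esym/eval_small_map.
exact/esym/(colim_in_compat (@small_map A r J n N)).
Qed.

Lemma colim_graph_fun U c : colim_graph U 0 c -> c = 0.
Proof.
move=> [hU [psi [/esym/(eval_inj (@sub_val_inj _)) -> ->]]].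
exact: linear0.
Qed.

Lemma colim_graph_total U phi : U `<=` ord_range -> (#|` U| <= N)%N ->
  dual_eval U phi -> exists c, colim_graph U phi c.
Proof.
move=> /fsubsetP UR hU /(dual_eval_onto (@sub_val_inj (ord_set U)))[].
  move=> t tU; have /imfsetP[i _ /= tE] := UR t tU.
  have iU : i \in ord_set U by rewrite inE; rewrite tE in tU.
  by exists (exist _ i iU).
by move=> psi phiE; exists (to_colim (small_ord_set hU) psi), hU, psi.
Qed.

Lemma colim_graph_in (S : small_set n N) (psi : small_dual A J S) :
  exists2 U, U `<=` ord_range &
  colim_graph U (eval (@sub_val (val S)) psi) (to_colim S psi).
Proof.
exists [fset val i | i in val S].
  by apply/fsubsetP => _ /imfsetP[i _ ->]; rewrite in_imfset.
have hU : (#|` [fset val i | i in val S]| <= N)%N.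
  by rewrite card_imfset; [rewrite -cardE; exact: valP S | exact: val_inj].
have le : small_le S (small_ord_set hU).
  by apply/subsetP => i iS; rewrite inE in_imfset.
exists hU, (small_map A J le psi); split; first exact/esym/eval_small_map.
exact/esym/(colim_in_compat (@small_map A r J n N)).
Qed.

Lemma colim_graph_to_dual U phi c : colim_graph U phi c ->
  phi = eval val (colim_to_dual A J n N c).
Proof.
move=> [hU [psi [-> ->]]]; rewrite /colim_to_dual colim_desc_in.
exact/esym/eval_small_to_full.
Qed.

Lemma glued_to_dual U phi c : glued colim_graph U phi c ->
  phi = eval val (colim_to_dual A J n N c).
Proof.
elim=> [|T phi' c' psi' d' _ hT _ ->]; first by rewrite linear0.
by rewrite (colim_graph_to_dual hT) linearD.
Qed.

(** The colimit is a quotient of the direct sum, so [c] is a sum of images of elements of small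
    duals, each of which lies in the graph. *)
Lemma glued_colim c : exists phi, glued colim_graph ord_range phi c.
Proof.
have [x ->] : exists x : dsum (@small_dual A r J n N),
  c = \sum_S to_colim S (x S).
  exists (repr (c : {ideal_quot _})).
  rewrite -[LHS]lquot_reprK -[RHS]linear_sum; congr lquot_pi; exact: dsumE.
eexists; apply: glued_sum => S _.
have [U UR h] := colim_graph_in (x S).
exact: glued_graph UR h.
Qed.

(** By [glued_to_dual], the map to the full dual recovers the glued function. Injectivity thus
    reduces to [glued_fun] and surjectivity to [glued_total], both for the set of all letters below
    [n]. *)
Lemma colim_to_dual_bij :
  (forall S, (N < #|` S|)%N ->
    exact0 (@dual_eval A r J) S S /\ exact1 (@dual_eval A r J) S S) ->
  bijective (colim_to_dual A J n N).
Proof.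
move=> ex.
have inj : injective (colim_to_dual A J n N).
  move=> c c' cc'; apply/eqP; rewrite -subr_eq0; apply/eqP.
  have [phi h] := glued_colim (c - c').
  have := glued_to_dual h; rewrite linearB cc' subrr => phi0.
  rewrite phi0 eval0 in h.
  exact: (glued_fun (dual_eval_fi A J) ex colim_graph_small colim_graph_dom
    colim_graphB colim_graph_mono colim_graph_fun colim_graph_total
      (fsubset_refl _) h).
have /choice[inv invK] psi : exists c, colim_to_dual A J n N c = psi.
  have [|c h] := glued_total ex colim_graph_total (fsubset_refl _) (phi :=
    eval val psi).
    exists 'I_n, val, psi; split=> // i.
    by rewrite in_imfset.
  exists c; apply/eqP; rewrite -subr_eq0; apply/eqP; apply: (eval_inj val_inj).
  have /eqP := glued_to_dual h; rewrite -subr_eq0 => /eqP hE.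
  by rewrite -oppr0 -hE; apply/funext => e; rewrite !fctE opprB.
by exists inv => [c|psi]; [apply: inj; rewrite invK | exact: invK].
Qed.
End SmallSubsets.

Theorem theorem1p13 (A : comNzRingType) (hA : noetherian A)
    (r : nat) (hr : (1 <= r)%N) (J : 'I_r -> nat) :
  exists N : nat, forall n : nat, bijective (colim_to_dual A J n N).
Proof.
(* The family [dual_eval] involves all finite sets of letters at once, so the bound does not depend
   on [n]. *)
have [N hN] := eventually_exact_fi hA (dual_eval_fi A J).
exists N => n; apply: colim_to_dual_bij => S NS.
by have := hN S (fsub0set S) NS; rewrite fsetD0.
Qed.
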